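(* Let $\nu>0$, $\Delta t>0$, and let $f^{\{k\}}$ be given. Let $f^{\{k+1\}}$ satisfy the backward Euler equation $$f^{\{k+1\}}+\Delta t\,vAf^{\{k+1\}}+\nu\Delta t f^{\{k+1\}}=f^{\{k\}}+\nu\Delta t\,\mathsf{M}\,n_{f^{\{k+1\}}},$$ and let $\{f^\ell\}_\ell$ be generated by the HOLO iteration $$f^{\ell+1}+\Delta t\,vAf^{\ell+1}+\nu\Delta t f^{\ell+1}=f^{\{k\}}+\nu\Delta t\,\mathsf{M}\,n^{\ell+1},$$ $$n^{\ell+1}+u_0\Delta t\,A n^{\ell+1}=n_{f^{\{k\}}}-\Delta t\,A\langle v(f^\ell-\mathsf{M}n_{f^\ell})\rangle_v,$$ where $n^{\ell+1}\in V_{x,h}$. Define $e^\ell=f^\ell-f^{\{k+1\}}$ and $$C_{\mathrm{HL}}:=\frac{\theta_0\,\Delta t^2/h_x^2}{1+u_0^2\,\Delta t^2/h_x^2}.$$ Then for any $1\le\delta\le2$, $$\Big(1+\tfrac{2-\delta}{2}\nu\Delta t\Big)\|P_{\mathsf M}e^{\ell+1}\|_{\mathsf M}^2+(1+\nu\Delta t)\|P_{\mathsf M}^\perp e^{\ell+1}\|_{\mathsf M}^2\le\frac{\nu\Delta t}{2\delta}\,C_{\mathrm{HL}}\,\|P_{\mathsf M}^\perp e^\ell\|_{\mathsf M}^2 .$$ Moreover, $$\|P_{\mathsf M}^\perp e^{\ell+1}\|_{\mathsf M}^2\le\frac14\,C_{\mathrm{HL}}\,\frac{\nu\Delta t}{1+\nu\Delta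 t}\,\|P_{\mathsf M}^\perp e^\ell\|_{\mathsf M}^2,\qquad \|P_{\mathsf M}e^{\ell+1}\|_{\mathsf M}^2\le C_{\mathrm{HL}}\,\frac{\nu\Delta t}{2+\nu\Delta t}\,\|P_{\mathsf M}^\perp e^\ell\|_{\mathsf M}^2 .$$
   Context: Setting: the linear BGK model $\partial_tf+v\partial_xf=\nu(n_f\mathsf{M}-f)$ with periodic boundary conditions in $x\in\Omega_x$ (a bounded interval), discretized in $x$ only (velocity $v\in\mathbb{R}$ is left continuous). Here $\langle\cdot\rangle_v=\int_{\mathbb{R}}(\cdot)\,dv$, $n_f=\langle f\rangle_v$, and, for constants $u_0\in\mathbb{R}$, $\theta_0>0$, $$\mathsf{M}(v)=\frac{1}{\sqrt{2\pi\theta_0}}\exp\left(-\frac{(v-u_0)^2}{2\theta_0}\right).$$ $V_{x,h}\subset L^2(\Omega_x)$ is a finite-dimensional (discontinuous piecewise polynomial) space with mesh parameter $h_x>0$. $\partial_x$ is discretized by central differences with periodic boundary conditions, giving a linear operator $A:V_{x,h}\to V_{x,h}$ that is skew-symmetric with respect to the $L^2(\Omega_x)$ inner product; its eigenvalues are of the form $i\lambda$ with $\lambda\in\mathbb{R}$, $|\lambda|\le 1/h_x$. $A$ acts on functions of $(x,v)$ in the $x$ variable for each fixed $v$. The inner product is $(w,z)_{\mathsf M}=\int_{\Omega_x\times\mathbb{R}}w\,z\,\mathsf{M}^{-1}\,dx\,dv$ with norm $\|\cdot\|_{\mathsf M}$. All functions $f^{\{k\}},f^{\{k+1\}},f^\ell$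 are functions of $(x,v)$ lying in $V_{x,h}$ as functions of $x$ and with finite $\|\cdot\|_{\mathsf M}$ norm. $P_{\mathsf M}w=\langle w\rangle_v\mathsf{M}=\mathsf{M}n_w$, which is an orthogonal projection for $(\cdot,\cdot)_{\mathsf M}$, and $P_{\mathsf M}^\perp=I-P_{\mathsf M}$. *)

(* Defs.v *)
From HB Require Import structures.
From mathcomp Require Import all_boot all_order all_algebra.
From mathcomp Require Import all_classical all_reals all_analysis.
From mathcomp Require Import complex.
Set Implicit Arguments.
Unset Strict Implicit.
Unset Printing Implicit Defensive.
Import Order.TTheory GRing.Theory Num.Theory.
Import numFieldNormedType.Exports.
Local Open Scope classical_set_scope.
Local Open Scope ring_scope.

Section BGK.
Context {R : realType}.
Local Notation mu := (@lebesgue_measure R).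

Definition Omega_x (a b : R) : set R := `[a, b].

(* A finite-dimensional subspace of L^2(a, b), given by one representative
   R -> R of each of its classes: by [L2_repr] the map from V to L^2(a, b) is
   injective.  In particular a function of V is determined by its restriction
   to [a, b]; its values outside are a mere convention (e.g. zero). *)
Record L2_findim (a b : R) (V : set (R -> R)) : Prop := {
  L2_zero : V (fun _ => 0);
  L2_lin : forall (c : R) (u w : R -> R),
    V u -> V w -> V (fun x => c * u x + w x);
  L2_sub : forall u : R -> R, V u -> u \_ (Omega_x a b) \in Lfun mu 2%:E;
  L2_repr : forall u : R -> R, V u ->
    {ae mu, forall x, Omega_x a b x -> u x = 0} -> u = (fun _ => 0);
  L2_fin : exists (n : nat) (phi : 'I_n -> R -> R), forall u : R -> R,
    V u -> exists c : 'I_n -> R, u = (fun x => \sum_(i < n) c i * phi i x) }.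

(* Operators on V are maps on all functions, of which only the values on V
   matter. *)
Definition linear_operator (V : set (R -> R)) (A : (R -> R) -> R -> R) : Prop :=
  (forall u : R -> R, V u -> V (A u)) /\
  (forall (c : R) (u w : R -> R), V u -> V w ->
     A (fun x => c * u x + w x) = (fun x => c * A u x + A w x)).

Definition inner_x (a b : R) (u w : R -> R) : R :=
  \int[mu]_(x in Omega_x a b) (u x * w x).

Definition skew_symmetric (a b : R) (V : set (R -> R))
    (A : (R -> R) -> R -> R) : Prop :=
  forall u w : R -> R, V u -> V w ->
    inner_x a b (A u) w = - inner_x a b u (A w).

(* Eigenvalues of the real operator A are those of its complexification, which
   acts on the functions z : R -> R[i] with real and imaginary parts in V. *)
Definition Re_fun (z : R -> R[i]) : R -> R := fun x => complex.Re (z x).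
Definition Im_fun (z : R -> R[i]) : R -> R := fun x => complex.Im (z x).

Definition complexification (A : (R -> R) -> R -> R) (z : R -> R[i]) :
    R -> R[i] :=
  fun x => Complex (A (Re_fun z) x) (A (Im_fun z) x).

Definition is_eigenvalue (V : set (R -> R)) (A : (R -> R) -> R -> R)
    (m : R[i]) : Prop :=
  exists z : R -> R[i], [/\ V (Re_fun z), V (Im_fun z), z <> (fun _ => 0)
    & complexification A z = (fun x => m * z x)].

Definition imaginary_spectrum (V : set (R -> R)) (A : (R -> R) -> R -> R)
    (h : R) : Prop :=
  forall m : R[i], is_eigenvalue V A m ->
    exists lambda : R, m = Complex 0 lambda /\ `|lambda| <= h^-1.

(* Functions of (x, v) are curried with x first: f x v. *)
Definition maxwellian (u0 theta0 v : R) : R :=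
  (Num.sqrt (2 * pi * theta0))^-1 * expR (- ((v - u0) ^+ 2 / (2 * theta0))).

Definition avg_v (g : R -> R) : R := \int[mu]_v g v.

Definition density (f : R -> R -> R) : R -> R := fun x => avg_v (f x).

Definition apply_x (A : (R -> R) -> R -> R) (f : R -> R -> R) : R -> R -> R :=
  fun x v => A (fun y => f y v) x.

Definition proj_M (u0 theta0 : R) (w : R -> R -> R) : R -> R -> R :=
  fun x v => maxwellian u0 theta0 v * density w x.

Definition proj_M_perp (u0 theta0 : R) (w : R -> R -> R) : R -> R -> R :=
  fun x v => w x v - proj_M u0 theta0 w x v.

Definition inner_M (a b u0 theta0 : R) (w z : R -> R -> R) : R :=
  \int[(mu \x mu)%E]_(p in Omega_x a b `*` setT)
    (w p.1 p.2 * z p.1 p.2 * (maxwellian u0 theta0 p.2)^-1).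

Definition norm_M (a b u0 theta0 : R) (w : R -> R -> R) : R :=
  Num.sqrt (inner_M a b u0 theta0 w w).

Definition finite_norm_M (a b u0 theta0 : R) (w : R -> R -> R) : Prop :=
  measurable_fun (Omega_x a b `*` setT) (fun p : R * R => w p.1 p.2) /\
  (\int[mu \x mu]_(p in Omega_x a b `*` setT)
     ((w p.1 p.2) ^+ 2 * (maxwellian u0 theta0 p.2)^-1)%:E < +oo)%E.

Definition kinetic_space (a b u0 theta0 : R) (V : set (R -> R))
    (f : R -> R -> R) : Prop :=
  (forall v : R, V (fun x => f x v)) /\ finite_norm_M a b u0 theta0 f.

(* Equation for g = f^{k+1} (resp. f^{l+1}) with density n on the right-hand
   side; as an identity in L^2, it is required for almost every v. *)
Definition kinetic_step (a b u0 theta0 nu dt : R) (A : (R -> R) -> R -> R)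
    (fk : R -> R -> R) (n : R -> R) (g : R -> R -> R) : Prop :=
  {ae mu, forall v, forall x, Omega_x a b x ->
    g x v + dt * (v * apply_x A g x v) + nu * dt * g x v
    = fk x v + nu * dt * (maxwellian u0 theta0 v * n x)}.

Definition backward_euler (a b u0 theta0 nu dt : R) (A : (R -> R) -> R -> R)
    (fk g : R -> R -> R) : Prop :=
  kinetic_step a b u0 theta0 nu dt A fk (density g) g.

Definition moment_flux (u0 theta0 : R) (f : R -> R -> R) : R -> R :=
  fun x => avg_v (fun v => v * (f x v - maxwellian u0 theta0 v * density f x)).

Definition low_order_step (a b u0 theta0 dt : R) (A : (R -> R) -> R -> R)
    (fk f : R -> R -> R) (n : R -> R) : Prop :=
  forall x, Omega_x a b x ->
    n x + u0 * dt * A n x = density fk x - dt * A (moment_flux u0 theta0 f) x.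

Definition HOLO_iteration (a b u0 theta0 nu dt : R) (V : set (R -> R))
    (A : (R -> R) -> R -> R) (fk : R -> R -> R)
    (f : nat -> R -> R -> R) (n : nat -> R -> R) : Prop :=
  forall l : nat, [/\ V (n l.+1),
    low_order_step a b u0 theta0 dt A fk (f l) (n l.+1)
    & kinetic_step a b u0 theta0 nu dt A fk (n l.+1) (f l.+1)].

Definition C_HL (u0 theta0 dt h : R) : R :=
  (theta0 * (dt ^+ 2 / h ^+ 2)) / (1 + u0 ^+ 2 * (dt ^+ 2 / h ^+ 2)).

End BGK.

(* Main.v *)
Require Import Defs.
From HB Require Import structures.
From mathcomp Require Import all_boot all_order all_algebra.
From mathcomp Require Import all_classical all_reals all_analysis.
From mathcomp Require Import measurable_realfun complex.
From mathcomp Require Import ring lra.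
Import Order.TTheory GRing.Theory Num.Theory.
Import numFieldNormedType.Exports.
Local Open Scope classical_set_scope.
Local Open Scope ring_scope.

Set Implicit Arguments.
Unset Strict Implicit.

(** Write [T = nu dt], and let [E] be the new error [e^(l+1)], [N] its density
    and [d] the difference between the low order density [n^(l+1)] and the
    density of [f^(k+1)].  Subtracting the two kinetic equations gives
    [E + dt v A E + T E = T M d].  Pairing this with [E / M] in [x] and [v]
    kills the transport term, because [A] is skew for each fixed [v], and leaves
    [(1 + T) (|N|^2 + |P^perp E|^2) = T (d, N)].  Young's inequality
    [(d, N) <= delta / 2 |N|^2 + |d|^2 / (2 delta)] lets the term in [|N|^2] be
    absorbed on the left and leaves [T / (2 delta) |d|^2] on the right; the last
    two claims come from [delta = 2] and [delta = 1] ([holo_scalar_estimates]).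

    It remains to see [|d|^2 <= C_HL |P^perp e^l|^2].  Integrating the backward
    Euler equation in [v] removes the collision terms and shows that the density
    of [f^(k+1)] satisfies the low order equation with its own flux
    ([kinetic_step_moment]).  Hence [(1 + u0 dt A) d = - dt A p], where [p] is
    the flux of [e^l].  Two facts finish the argument.
    - A skew matrix is unitarily diagonalisable, so the spectral bound
      [|lambda| <= 1 / h] is a bound [|A w| <= |w| / h] on all of [V].  With
      [w = (1 + u0 dt A)^-1 p] one has [d = - dt A w] and
      [|p|^2 = |w|^2 + u0^2 dt^2 |A w|^2], which turns this bound into the one on
      the resolvent ([skew_resolvent_bound]).
    - The flux is the integral of [(v - u0) P^perp e^l], since [P^perp e^l] has
      no mass; Cauchy-Schwarz and the variance [theta0] of the Maxwellian give
      [|p|^2 <= theta0 |P^perp e^l|^2] ([flux_sqr_le]).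

    All this is carried out in the coordinates of an orthonormal basis of [V]:
    a kinetic function is then a column vector of functions of [v], each of them
    square integrable against [1 / M] ([kinetic_expands]), and the weighted norm
    is the sum of their weighted norms, by Tonelli ([norm_M_expands]). *)

(** * Real-valued integrals *)

Section RealIntegrals.
Context d (T : measurableType d) (R : realType).
Variables (mu : {measure set T -> \bar R}) (D : set T).
Hypothesis mD : measurable D.
Implicit Types f g : T -> R.

Local Notation integrable_on f := (mu.-integrable D (EFin \o f)).

Lemma RintegrableD f g : integrable_on f -> integrable_on g ->
  integrable_on (fun x => f x + g x).
Proof. by move=> fi gi; have := integrableD mD fi gi. Qed.

Lemma RintegrableZ c f : integrable_on f -> integrable_on (fun x => c * f x).
Proof. by move=> fi; have := integrableZl mD c fi. Qed.

Lemma RintegrableB f g : integrable_on f -> integrable_on g ->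
  integrable_on (fun x => f x - g x).
Proof. by move=> fi gi; have := integrableB mD fi gi. Qed.

Lemma eq_Rintegrable f g : integrable_on f -> f =1 g -> integrable_on g.
Proof. by move=> fi /funext <-. Qed.

Lemma Rintegrable_sum (I : finType) (f : I -> T -> R) :
  (forall i, integrable_on (f i)) -> integrable_on (fun x => \sum_i f i x).
Proof.
move=> fi.
have := @integrable_sum _ _ _ mu D mD I (index_enum I) xpredT
  (fun i => EFin \o f i) (fun i _ => fi i).
by apply: eq_integrable => // x _; rewrite /= sumEFin.
Qed.

Lemma Rintegral_sum (I : finType) (f : I -> T -> R) :
  (forall i, integrable_on (f i)) ->
  \int[mu]_(x in D) (\sum_i f i x) = \sum_i \int[mu]_(x in D) f i x.
Proof.
move=> fi; rewrite {1}/Rintegral.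
under eq_integral do rewrite -sumEFin.
rewrite (@integral_sum _ _ _ mu D mD I (fun i => EFin \o f i)) //.
by rewrite -sum_fine// => i _; exact: integrable_fin_num.
Qed.

Lemma le_Rintegrable f g : measurable_fun D f ->
  (forall x, D x -> `|f x| <= g x) -> integrable_on g -> integrable_on f.
Proof.
move=> mf fg gi; apply: (le_integrable mD _ _ gi).
  exact/measurable_EFinP.
by move=> x Dx; rewrite /= lee_fin (le_trans (fg x Dx))// ler_norm.
Qed.

Lemma ae_eq_Rintegral f g : integrable_on f -> integrable_on g ->
  {ae mu, forall x, D x -> f x = g x} ->
  \int[mu]_(x in D) f x = \int[mu]_(x in D) g x.
Proof.
move=> fi gi fg; congr fine; apply: ae_eq_integral => //.
- exact: measurable_int fi.
- exact: measurable_int gi.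
- by apply: filterS fg => x /[swap] Dx /(_ Dx) ->.
Qed.

End RealIntegrals.

(** * Moments of the Maxwellian *)

Section GaussianMoments.
Context {R : realType}.
Local Notation mu := (@lebesgue_measure R).
Local Notation integrable_on f := (mu.-integrable setT (EFin \o f)).

(** This is [2 cosh x - 2 = (2 sinh (x / 2))^2 >= x^2]. *)
Lemma cosh_lower_bound (x : R) : 2 + x ^+ 2 <= expR x + expR (- x).
Proof.
(* sinh z >= z for z >= 0, since the difference has derivative cosh z - 1. *)
have sinh_ge (z : R) : 0 <= z -> 2 * z <= expR z - expR (- z).
  move=> z0; pose f (y : R) := expR y - expR (- y) - 2 * y.
  have df (y : R) : is_derive y (1 : R) f (expR y + expR (- y) - 2).
    rewrite /f; apply: is_derive_eq.
    by rewrite /GRing.scale /=; ring.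
  rewrite -subr_ge0 -/(f z) (_ : 0 = f 0); last first.
    by rewrite /f oppr0 expR0; ring.
  apply: (@ger0_derive1_ndecry _ f 0) => //.
  - move=> y _; rewrite derive1E (@derive_val _ _ _ _ _ _ _ (df y)).
    have := expR_gt0 y; have : expR y * expR (- y) = 1 by rewrite -expRD subrr expR0.
    have := expR_gt0 (- y); move: (expR y) (expR (- y)) => a b b0 ab a0.
    by have := sqr_ge0 (a - b); nra.
  - apply/continuous_subspaceT => y; apply/differentiable_continuous.
    exact/derivable1_diffP.
have half : x = x / 2 + x / 2 by lra.
wlog x0 : x half / 0 <= x.
  move=> H; have [|xN] := leP 0 x; first exact: H.
  have := H (- x); rewrite sqrrN opprK (addrC (expR _)); apply; lra.
have := sinh_ge (x / 2); set a := expR (x / 2); set b := expR (- (x / 2)).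
have -> : expR x = a ^+ 2 by rewrite expr2 -expRD -half.
have -> : expR (- x) = b ^+ 2 by rewrite expr2 -expRD -opprD -half.
have ab : a * b = 1 by rewrite -expRD subrr expR0.
move=> /(_ ltac:(lra)) h.
have : x ^+ 2 <= (a - b) ^+ 2 by rewrite ler_sqr ?nnegrE; lra.
by nra.
Qed.

Lemma maxwellian_gt0 (u0 theta0 : R) (v : R) : 0 < theta0 -> 0 < maxwellian u0 theta0 v.
Proof.
move=> t0; rewrite mulr_gt0 ?expR_gt0// invr_gt0 sqrtr_gt0.
by rewrite !mulr_gt0 ?pi_gt0.
Qed.

Lemma maxwellian_normal_pdf (u0 theta0 : R) : 0 < theta0 ->
  maxwellian u0 theta0 = normal_pdf u0 (Num.sqrt theta0).
Proof.
move=> t0; rewrite normal_pdfE ?gt_eqF ?sqrtr_gt0//.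
apply/funext => v; rewrite /maxwellian /normal_peak /normal_fun.
rewrite sqr_sqrtr ?ltW//; congr (_ * expR _); last first.
  by rewrite mulNr -(mulr_natl theta0).
by congr (Num.sqrt _)^-1; rewrite -mulr_natl; ring.
Qed.

Lemma measurable_maxwellian (u0 theta0 : R) : 0 < theta0 ->
  measurable_fun setT (maxwellian u0 theta0).
Proof.
by move=> t0; rewrite maxwellian_normal_pdf//; exact: measurable_normal_pdf.
Qed.

Lemma integrable_maxwellian (u0 theta0 : R) : 0 < theta0 ->
  integrable_on (maxwellian u0 theta0).
Proof.
by move=> t0; rewrite maxwellian_normal_pdf//; exact: integrable_normal_pdf.
Qed.

Lemma Rintegral_maxwellian (u0 theta0 : R) : 0 < theta0 ->
  \int[mu]_v maxwellian u0 theta0 v = 1.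
Proof.
move=> t0; rewrite maxwellian_normal_pdf// /Rintegral.
by rewrite integral_normal_pdf.
Qed.

(** Completing the square: an exponential tilt of a Maxwellian is a multiple of
    a shifted Maxwellian.  All moments below come from this identity, through
    comparison of powers of [v - u0] with exponentials. *)
Lemma maxwellian_tilt (u0 theta0 : R) (t v : R) : 0 < theta0 ->
  expR (t * (v - u0)) * maxwellian u0 theta0 v =
  expR (t ^+ 2 * theta0 / 2) * maxwellian (u0 + t * theta0) theta0 v.
Proof.
move=> t0; rewrite /maxwellian !(mulrCA (expR _)) -!expRD.
by congr (_ * expR _); field; rewrite gt_eqF.
Qed.

Lemma integrable_maxwellian_exp (u0 theta0 : R) (t : R) : 0 < theta0 ->
  integrable_on (fun v => expR (t * (v - u0)) * maxwellian u0 theta0 v).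
Proof.
move=> t0; under eq_fun do rewrite maxwellian_tilt//.
by apply: RintegrableZ => //; exact: integrable_maxwellian.
Qed.

Lemma maxwellian_mgf (u0 theta0 : R) (t : R) : 0 < theta0 ->
  \int[mu]_v (expR (t * (v - u0)) * maxwellian u0 theta0 v) =
  expR (t ^+ 2 * theta0 / 2).
Proof.
move=> t0; under eq_Rintegral do rewrite maxwellian_tilt//.
rewrite RintegralZl//; last exact: integrable_maxwellian.
by rewrite Rintegral_maxwellian// mulr1.
Qed.

Lemma measurable_power_maxwellian (u0 theta0 : R) (k : nat) : 0 < theta0 ->
  measurable_fun setT (fun v : R => (v - u0) ^+ k * maxwellian u0 theta0 v).
Proof.
move=> t0; apply: measurable_funM; last exact: measurable_maxwellian.
by apply: measurable_funX; exact: measurable_funB.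
Qed.

(** A dominating function for the second moment whose integral is explicit. *)
Lemma square_le_cosh (u0 theta0 : R) (t v : R) : 0 < theta0 -> 0 < t ->
  (v - u0) ^+ 2 * maxwellian u0 theta0 v <=
  t ^- 2 * (expR (t * (v - u0)) * maxwellian u0 theta0 v
    + expR (- t * (v - u0)) * maxwellian u0 theta0 v
    - 2 * maxwellian u0 theta0 v).
Proof.
move=> t0 tt; rewrite [leRHS]mulrC ler_pdivlMr ?exprn_gt0//.
have := maxwellian_gt0 u0 v t0; have := cosh_lower_bound (t * (v - u0)).
by rewrite mulNr exprMn; nra.
Qed.

Let integrable_cosh (u0 theta0 : R) (t : R) : 0 < theta0 ->
  integrable_on (fun v => t ^- 2 * (expR (t * (v - u0)) * maxwellian u0 theta0 v
    + expR (- t * (v - u0)) * maxwellian u0 theta0 v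
    - 2 * maxwellian u0 theta0 v)).
Proof.
move=> t0; apply: RintegrableZ => //; apply: RintegrableB => //.
  by apply: RintegrableD => //; exact: integrable_maxwellian_exp.
by apply: RintegrableZ => //; exact: integrable_maxwellian.
Qed.

Lemma integrable_maxwellian_square (u0 theta0 : R) : 0 < theta0 ->
  integrable_on (fun v : R => (v - u0) ^+ 2 * maxwellian u0 theta0 v).
Proof.
move=> t0; apply: (le_Rintegrable _ _ _ (integrable_cosh u0 1 t0)) => //.
  exact: measurable_power_maxwellian.
move=> v _; rewrite ger0_norm ?square_le_cosh//.
by rewrite mulr_ge0 ?sqr_ge0// ltW// maxwellian_gt0.
Qed.

(** A form of [exp s - 1 = s + O(s^2)] without division. *)
Lemma expR_sub1_le (s : R) : 0 <= s -> s < 1 -> (expR s - 1) * (1 - s) <= s.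
Proof.
move=> s0 s1; have := expR_ge1Dx (- s); have := expR_gt0 s.
have : expR s * expR (- s) = 1 by rewrite -expRD subrr expR0.
by move: (expR s) (expR (- s)) => a b; nra.
Qed.

(** Integrating [square_le_cosh] bounds the variance by [theta0 (exp s - 1) / s]
    with [s = t^2 theta0 / 2], and [s] is arbitrary in (0, 1). *)
Lemma maxwellian_variance_le (u0 theta0 : R) : 0 < theta0 ->
  \int[mu]_v ((v - u0) ^+ 2 * maxwellian u0 theta0 v) <= theta0.
Proof.
move=> t0; set I := Rintegral _ _ _.
have step s : 0 < s -> s < 1 -> I * (1 - s) <= theta0.
  move=> s0 s1.
  (* s = t^2 theta0 / 2 *)
  pose t := Num.sqrt (2 * s / theta0).
  have t2 : t ^+ 2 = 2 * s / theta0.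
    by rewrite sqr_sqrtr// divr_ge0 ?mulr_ge0// ltW.
  have tt : 0 < t by rewrite sqrtr_gt0 divr_gt0 ?mulr_gt0.
  have : I <= theta0 / s * (expR s - 1).
    apply: le_trans.
      apply: (@le_Rintegral _ _ _ mu setT _ _ _ _ _
        (fun v _ => square_le_cosh u0 v t0 tt)) => //.
      - exact: integrable_maxwellian_square.
      - exact: integrable_cosh.
    rewrite RintegralZl//; last first.
      apply: RintegrableB => //.
        by apply: RintegrableD => //; exact: integrable_maxwellian_exp.
      by apply: RintegrableZ => //; exact: integrable_maxwellian.
    rewrite RintegralB//; last 2 first.
      - by apply: RintegrableD => //; exact: integrable_maxwellian_exp.
      - by apply: RintegrableZ => //; exact: integrable_maxwellian.
    rewrite RintegralD//; try exact: integrable_maxwellian_exp.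
    rewrite RintegralZl//; last exact: integrable_maxwellian.
    rewrite !maxwellian_mgf// Rintegral_maxwellian// sqrrN t2.
    have -> : 2 * s / theta0 * theta0 / 2 = s by field; rewrite gt_eqF.
    rewrite le_eqVlt; apply/orP; left; apply/eqP.
    by field; rewrite !gt_eqF.
  move=> h; apply: (@le_trans _ _ (theta0 / s * (expR s - 1) * (1 - s))).
    by apply: ler_wpM2r => //; lra.
  rewrite -mulrA -[leRHS]mulr1 -mulrA ler_pM2l// mulrC ler_pdivrMr// mul1r.
  by apply: expR_sub1_le => //; exact: ltW.
apply/ler_addgt0Pl => e e0.
have [I0|I0] := leP I 0; first by lra.
have [Ie|Ie] := leP I e; first by lra.
have := step (e / I); rewrite divr_gt0// ltr_pdivrMr// mul1r Ie.
by rewrite mulrBr mulr1 mulrC divfK ?gt_eqF//; move=> /(_ isT isT); lra.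
Qed.

Lemma integrable_maxwellian_center (u0 theta0 : R) : 0 < theta0 ->
  integrable_on (fun v : R => (v - u0) * maxwellian u0 theta0 v).
Proof.
move=> t0; apply: (@le_Rintegrable _ _ _ mu setT _ _
  (fun v => maxwellian u0 theta0 v + (v - u0) ^+ 2 * maxwellian u0 theta0 v)) => //.
- exact: (measurable_power_maxwellian u0 1).
- move=> v _; rewrite normrM (ger0_norm (ltW (maxwellian_gt0 _ _ t0))).
  rewrite -{2}[maxwellian u0 theta0 v]mul1r -mulrDl.
  apply: ler_wpM2r; first by rewrite ltW// maxwellian_gt0.
  rewrite ler_norml; move: (v - u0) => w.
  by apply/andP; split; have := sqr_ge0 (w - 1); have := sqr_ge0 (w + 1); nra.
- apply: RintegrableD => //; first exact: integrable_maxwellian.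
  exact: integrable_maxwellian_square.
Qed.

(** By [1 + t y <= exp (t y)], the mean [I] satisfies
    [1 + t I <= exp (t^2 theta0 / 2)] for every [t] of either sign, so it
    vanishes. *)
Lemma maxwellian_center (u0 theta0 : R) : 0 < theta0 ->
  \int[mu]_v ((v - u0) * maxwellian u0 theta0 v) = 0.
Proof.
move=> theta0_gt0; set I := Rintegral _ _ _.
have step t : 1 + t * I <= expR (t ^+ 2 * theta0 / 2).
  rewrite -(maxwellian_mgf u0 t theta0_gt0)// -(Rintegral_maxwellian u0 theta0_gt0)//.
  have ci := integrable_maxwellian_center u0 theta0_gt0.
  rewrite -RintegralZl// -RintegralD//; last 2 first.
  - exact: integrable_maxwellian.
  - exact: RintegrableZ.
  apply: le_Rintegral => //.
  - by apply: RintegrableD => //; [exact: integrable_maxwellian|exact: RintegrableZ].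
  - exact: integrable_maxwellian_exp.
  move=> v _; rewrite mulrA -{1}[maxwellian u0 theta0 v]mul1r -mulrDl.
  by rewrite ler_wpM2r ?expR_ge1Dx// ltW// maxwellian_gt0.
(* With t = r I the inequality reads r I^2 <= O(r^2); the value of r below
   makes the three terms of rE sum to 1, which is small enough. *)
apply/eqP/negPn/negP => I0.
have I2 : 0 < I ^+ 2 by rewrite lt0r sqrf_eq0 I0 sqr_ge0.
pose r := (1 + theta0 + theta0 * I ^+ 2)^-1.
have r0 : 0 < r by rewrite invr_gt0 !addr_gt0// mulr_gt0.
have rE : r + r * theta0 + r * theta0 * I ^+ 2 = 1.
  by rewrite /r; field; rewrite gt_eqF// !addr_gt0// mulr_gt0.
have q0 : 0 < r * theta0 by rewrite mulr_gt0.
have q2 : 0 < r * theta0 * I ^+ 2 by rewrite mulr_gt0.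
have rI : 0 < r * I ^+ 2 by rewrite mulr_gt0.
have := step (r * I); set s := _ / 2.
have sE : s = r * I ^+ 2 * (r * theta0) / 2 by rewrite /s; field.
have s0 : 0 < s by rewrite sE divr_gt0// mulr_gt0.
have s1 : s < 1.
  have : s = r * (r * theta0 * I ^+ 2) / 2 by rewrite sE; field.
  by nra.
have := expR_sub1_le (ltW s0) s1; have -> : r * I * I = r * I ^+ 2 by ring.
move=> h1 h2.
have : r * I ^+ 2 * (1 - s) <= r * I ^+ 2 * (r * theta0 / 2).
  apply: (@le_trans _ _ ((expR s - 1) * (1 - s))); last by rewrite mulrA -sE.
  by apply: ler_wpM2r; lra.
rewrite ler_pM2l//.
have : s = r * (r * theta0 * I ^+ 2) / 2 by rewrite sE; field.
nra.
Qed.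

End GaussianMoments.

(** * Functions of the velocity, square integrable against the inverse Maxwellian *)

Section WeightedL2.
Context {R : realType}.
Variables (u0 theta0 : R).
Hypothesis theta0_gt0 : 0 < theta0.
Local Notation mu := (@lebesgue_measure R).
Local Notation integrable_on f := (mu.-integrable setT (EFin \o f)).
Local Notation M := (maxwellian u0 theta0).
Implicit Types c e : R -> R.

Definition weighted_L2 c : Prop :=
  measurable_fun setT c /\ integrable_on (fun v => c v ^+ 2 * (M v)^-1).

Let M_gt0 v : 0 < M v. Proof. exact: maxwellian_gt0. Qed.
Let M_neq0 v : M v != 0. Proof. by rewrite gt_eqF. Qed.

Lemma measurable_inv_maxwellian : measurable_fun setT (fun v => (M v)^-1).
Proof.
suff -> : (fun v => (M v)^-1) =
    (fun v => (Num.sqrt (2 * pi * theta0)) * expR ((v - u0) ^+ 2 / (2 * theta0))).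
  apply: measurable_funM => //; apply: measurableT_comp => //.
  apply: measurable_funM => //; apply: measurable_funX.
  exact: measurable_funB.
by apply/funext => v; rewrite /maxwellian invfM invrK -expRN opprK.
Qed.

Lemma weighted_L2_mul c e : weighted_L2 c -> weighted_L2 e ->
  integrable_on (fun v => c v * e v * (M v)^-1).
Proof.
move=> [mc ci] [me ei]; apply: (le_Rintegrable _ _ _ (RintegrableD _ ci ei)) => //.
  apply: measurable_funM; first exact: measurable_funM.
  exact: measurable_inv_maxwellian.
move=> v _; rewrite normrM (gtr0_norm (x := (M v)^-1)) ?invr_gt0// -mulrDl.
apply: ler_wpM2r; first by rewrite ltW// invr_gt0.
move: (c v) (e v) => x y; rewrite ler_norml.
by apply/andP; split; have := sqr_ge0 (x - y); have := sqr_ge0 (x + y); nra.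
Qed.

Lemma weighted_L2_lin k c e : weighted_L2 c -> weighted_L2 e ->
  weighted_L2 (fun v => k * c v + e v).
Proof.
move=> hc he; have [[mc ci] [me ei]] := (hc, he).
split; first by apply: measurable_funD => //; exact: measurable_funM.
have := weighted_L2_mul hc he => cei.
apply: (eq_Rintegrable (RintegrableD measurableT
  (RintegrableD measurableT (RintegrableZ measurableT (k ^+ 2) ci) ei)
  (RintegrableZ measurableT (2 * k) cei))) => v /=.
by ring.
Qed.

Lemma weighted_L2_maxwellian : weighted_L2 M.
Proof.
split; first exact: measurable_maxwellian.
apply: (eq_Rintegrable (integrable_maxwellian u0 theta0_gt0)) => v /=.
by field.
Qed.

Lemma weighted_L2Z k c : weighted_L2 c -> weighted_L2 (fun v => k * c v).
Proof.
move=> hc; have := weighted_L2_lin (k - 1) hc hc.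
by congr weighted_L2; apply/funext => v; ring.
Qed.

Lemma weighted_L2B c e : weighted_L2 c -> weighted_L2 e ->
  weighted_L2 (fun v => c v - e v).
Proof.
move=> hc he; have := weighted_L2_lin (- 1) he hc.
by congr weighted_L2; apply/funext => v; ring.
Qed.

Lemma weighted_L2_integrable c : weighted_L2 c -> integrable_on c.
Proof.
move=> hc; apply: (eq_Rintegrable (weighted_L2_mul hc weighted_L2_maxwellian)).
by move=> v /=; field.
Qed.

(** [|w c| <= c^2 / M + w^2 M] with [w = v - u0]: the Gaussian weight absorbs the
    unbounded factor. *)
Lemma weighted_L2_center_integrable c : weighted_L2 c ->
  integrable_on (fun v => (v - u0) * c v).
Proof.
move=> [mc ci].
apply: (le_Rintegrable _ _ _
  (RintegrableD _ ci (integrable_maxwellian_square u0 theta0_gt0))) => //.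
  by apply: measurable_funM => //; exact: measurable_funB.
move=> v _; move: (v - u0) (c v) (M v) (M_gt0 v) => w x m m0.
rewrite -(ler_pM2r m0) mulrDl divfK ?gt_eqF//.
rewrite -[X in _ * X](gtr0_norm m0) -normrM ler_norml.
by apply/andP; split; have := sqr_ge0 (w * m - x);
  have := sqr_ge0 (w * m + x); nra.
Qed.

Lemma weighted_L2_moment_integrable c : weighted_L2 c ->
  integrable_on (fun v => v * c v).
Proof.
move=> hc; apply: (eq_Rintegrable (RintegrableD measurableT
  (weighted_L2_center_integrable hc)
  (RintegrableZ measurableT u0 (weighted_L2_integrable hc)))) => v /=.
by ring.
Qed.

Definition mass c : R := \int[mu]_v c v.
(** The part of [c] orthogonal to the Maxwellian, i.e. [P^perp] in one
    coordinate. *)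
Definition micro c : R -> R := fun v => c v - M v * mass c.
Definition flux c : R := \int[mu]_v (v * micro c v).
Definition energy c : R := \int[mu]_v (c v ^+ 2 * (M v)^-1).

Lemma energy_ge0 c : 0 <= energy c.
Proof.
by apply: Rintegral_ge0 => v _; rewrite mulr_ge0 ?sqr_ge0// invr_ge0 ltW.
Qed.

Lemma weighted_L2_micro c : weighted_L2 c -> weighted_L2 (micro c).
Proof.
move=> hc; have := weighted_L2B hc (weighted_L2Z (mass c) weighted_L2_maxwellian).
by congr weighted_L2; apply/funext => v; rewrite /micro mulrC.
Qed.

Lemma mass_micro c : weighted_L2 c -> mass (micro c) = 0.
Proof.
move=> hc; have Mi := integrable_maxwellian u0 theta0_gt0.
rewrite {1}/mass /micro RintegralB//; first last.
- by under eq_fun do rewrite mulrC; exact: RintegrableZ.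
- exact: weighted_L2_integrable.
by rewrite RintegralZr// Rintegral_maxwellian// mul1r subrr.
Qed.

(** Orthogonality of the two projections; the Maxwellian has unit energy. *)
Lemma energy_pythagoras c : weighted_L2 c ->
  energy c = mass c ^+ 2 + energy (micro c).
Proof.
move=> hc; have Mi := integrable_maxwellian u0 theta0_gt0.
have ci := weighted_L2_integrable hc.
rewrite /energy (_ : (fun v => micro c v ^+ 2 * (M v)^-1) =
   (fun v => (c v ^+ 2 * (M v)^-1 - 2 * mass c * c v) + mass c ^+ 2 * M v)).
  rewrite RintegralD//; first last.
  - exact: RintegrableZ.
  - by apply: RintegrableB => //; [case: hc|exact: RintegrableZ].
  rewrite RintegralB//; [|by case: hc|exact: RintegrableZ].
  rewrite (RintegralZl _ measurableT ci) (RintegralZl _ measurableT Mi).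
  by rewrite Rintegral_maxwellian// -/(mass c); ring.
by apply/funext => v; rewrite /micro; field.
Qed.

(** The Maxwellian part moves with velocity [u0] and the remainder contributes
    the flux. *)
Lemma moment_flux_mass c : weighted_L2 c ->
  \int[mu]_v (v * c v) = u0 * mass c + flux c.
Proof.
move=> hc; have Mi := integrable_maxwellian u0 theta0_gt0.
have mi := weighted_L2_moment_integrable (weighted_L2_micro hc).
have Ci := integrable_maxwellian_center u0 theta0_gt0.
rewrite (_ : (fun v => v * c v) = (fun v => v * micro c v +
    (mass c * ((v - u0) * M v) + u0 * mass c * M v))); last first.
  by apply/funext => v; rewrite /micro; ring.
rewrite RintegralD//; last by apply: RintegrableD => //; exact: RintegrableZ.
rewrite RintegralD//; [|exact: RintegrableZ..].
rewrite (RintegralZl _ measurableT Ci) (RintegralZl _ measurableT Mi).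
by rewrite Rintegral_maxwellian// maxwellian_center// /flux; ring.
Qed.

Lemma massB c e : weighted_L2 c -> weighted_L2 e ->
  mass (fun v => c v - e v) = mass c - mass e.
Proof. by move=> hc he; rewrite /mass RintegralB//; exact: weighted_L2_integrable. Qed.

Lemma fluxB c e : weighted_L2 c -> weighted_L2 e ->
  flux (fun v => c v - e v) = flux c - flux e.
Proof.
move=> hc he; rewrite /flux -RintegralB//; last 2 first.
- exact/weighted_L2_moment_integrable/weighted_L2_micro.
- exact/weighted_L2_moment_integrable/weighted_L2_micro.
by apply: eq_Rintegral => v _; rewrite /micro massB//; ring.
Qed.

(** Cauchy-Schwarz for [(v - u0) sqrt M] and [micro c / sqrt M], in the form of
    the pointwise inequality
    [2 q (v - u0) r <= theta0 r^2 / M + q^2 (v - u0)^2 M / theta0]. *)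
Lemma flux_sqr_le c : weighted_L2 c -> flux c ^+ 2 <= theta0 * energy (micro c).
Proof.
move=> hc; have hm := weighted_L2_micro hc.
have mi := weighted_L2_integrable hm.
have ci := weighted_L2_center_integrable hm.
have Si := integrable_maxwellian_square u0 theta0_gt0.
set q := flux c; set E := energy _.
(* the micro part has no mass, so v may be replaced by v - u0 *)
have qE : q = \int[mu]_v ((v - u0) * micro c v).
  rewrite /q /flux (_ : (fun v => v * micro c v) =
    (fun v => (v - u0) * micro c v + u0 * micro c v)); last first.
    by apply/funext => v; ring.
  rewrite RintegralD//; last exact: RintegrableZ.
  by rewrite RintegralZl// -/(mass (micro c)) mass_micro// mulr0 addr0.
have : 2 * q * q <= theta0 * E + theta0^-1 * q ^+ 2 * theta0.
  rewrite {2}qE -RintegralZl//.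
  apply: (@le_trans _ _ (\int[mu]_v (theta0 * (micro c v ^+ 2 * (M v)^-1) +
     theta0^-1 * q ^+ 2 * ((v - u0) ^+ 2 * M v)))).
    apply: le_Rintegral => //.
    - exact: RintegrableZ.
    - by apply: RintegrableD => //; apply: RintegrableZ => //; case: hm.
    move=> v _; move: (v - u0) (micro c v) (M v) (M_gt0 v) => w x m m0.
    rewrite -subr_ge0 (_ : _ - _ = (theta0 * m)^-1 * (theta0 * x - q * w * m) ^+ 2).
      by rewrite mulr_ge0 ?sqr_ge0// invr_ge0 mulr_ge0// ltW.
    by field; rewrite !gt_eqF.
  rewrite RintegralD//; [|apply: RintegrableZ => //; by case: hm|exact: RintegrableZ].
  rewrite !RintegralZl//; last by case: hm.
  apply: lerD => //; apply: ler_wpM2l; last exact: maxwellian_variance_le.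
  by rewrite mulr_ge0 ?sqr_ge0// invr_ge0 ltW.
have -> : theta0^-1 * q ^+ 2 * theta0 = q ^+ 2 by field; rewrite gt_eqF.
lra.
Qed.

End WeightedL2.

(** * The discrete space and its orthonormal bases *)

Section DiscreteSpace.
Context {R : realType}.
Local Notation mu := (@lebesgue_measure R).
Variables (a b : R) (V : set (R -> R)).
Hypothesis hV : L2_findim a b V.
Local Notation Om := (Omega_x a b).
Local Notation ip := (inner_x a b).
Implicit Types u w : R -> R.

Lemma measurable_Omega : measurable (Om : set (measurableTypeR R)).
Proof. exact: measurable_itv. Qed.
Let mOm := measurable_Omega.

Lemma space_sum (I : Type) (s : seq I) (k : I -> R) (u : I -> R -> R) :
  (forall i, V (u i)) -> V (fun x => \sum_(i <- s) k i * u i x).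
Proof.
move=> hu; elim: s => [|i s IH].
  by have := L2_zero hV; congr V; apply/funext => x; rewrite big_nil.
have := L2_lin hV (k i) (hu i) IH.
by congr V; apply/funext => x; rewrite big_cons.
Qed.

Lemma spaceZ k u : V u -> V (fun x => k * u x).
Proof.
move=> hu; have := L2_lin hV k hu (L2_zero hV).
by congr V; apply/funext => x; rewrite addr0.
Qed.

Lemma spaceB u w : V u -> V w -> V (fun x => u x - w x).
Proof.
move=> hu hw; have := L2_lin hV (- 1) hw hu.
by congr V; apply/funext => x; ring.
Qed.

Lemma space_measurable u : V u -> measurable_fun Om u.
Proof.
move=> /(L2_sub hV); rewrite inE /= => /andP[].
by rewrite inE => /= mu_ _; apply/measurable_restrictT.
Qed.

Lemma space_sqr_integrable u : V u -> mu.-integrable Om (EFin \o (fun x => u x ^+ 2)).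
Proof.
move=> /(L2_sub hV) /Lfun2_integrable_sqr h.
apply/integrable_mkcond => //; apply: eq_integrable h => // x _.
by rewrite /= !patchE; case: ifP => //= _; rewrite expr0n.
Qed.

Lemma space_mul_integrable u w : V u -> V w ->
  mu.-integrable Om (EFin \o (fun x => u x * w x)).
Proof.
move=> hu hw; apply: (le_Rintegrable mOm _ _ (RintegrableD mOm
  (space_sqr_integrable hu) (space_sqr_integrable hw))).
  by apply: measurable_funM; exact: space_measurable.
move=> x _; rewrite ler_norml; move: (u x) (w x) => y z.
by apply/andP; split; have := sqr_ge0 (y - z); have := sqr_ge0 (y + z); nra.
Qed.

Lemma inner_xC u w : ip u w = ip w u.
Proof. by apply: eq_Rintegral => x _; rewrite mulrC. Qed.

Lemma inner_x_suml (I : finType) (k : I -> R) (u : I -> R -> R) w :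
  (forall i, V (u i)) -> V w ->
  ip (fun x => \sum_i k i * u i x) w = \sum_i k i * ip (u i) w.
Proof.
move=> hu hw; rewrite /inner_x.
under eq_Rintegral do rewrite mulr_suml.
rewrite Rintegral_sum//.
  apply: eq_bigr => i _; under eq_Rintegral do rewrite -mulrA.
  by rewrite RintegralZl//; exact: space_mul_integrable.
move=> i; apply: (eq_Rintegrable (RintegrableZ mOm (k i)
  (space_mul_integrable (hu i) hw))) => x.
by rewrite mulrA.
Qed.

Lemma inner_xZ k u w : V u -> V w -> ip (fun x => k * u x) w = k * ip u w.
Proof.
move=> hu hw; rewrite /inner_x; under eq_Rintegral do rewrite -mulrA.
by rewrite RintegralZl//; exact: space_mul_integrable.
Qed.

Lemma inner_xB u1 u2 w : V u1 -> V u2 -> V w ->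
  ip (fun x => u1 x - u2 x) w = ip u1 w - ip u2 w.
Proof.
move=> h1 h2 hw; rewrite /inner_x; under eq_Rintegral do rewrite mulrBl.
by rewrite RintegralB//; exact: space_mul_integrable.
Qed.

Lemma inner_x_ge0 u : 0 <= ip u u.
Proof. by apply: Rintegral_ge0 => x _; rewrite -expr2 sqr_ge0. Qed.

(** Functions of [V] are determined on the interval, so equations posed there
    hold as equations in [V]. *)
Lemma space_eqP u w : V u -> V w -> (forall x, Om x -> u x = w x) -> u = w.
Proof.
move=> hu hw uw; have /(L2_repr hV) H := spaceB hu hw.
have : (fun x => u x - w x) = (fun=> 0).
  by apply: H; apply: aeW => x Ox; rewrite uw// subrr.
by move=> /funeqP E; apply/funext => x; have := E x => /eqP; rewrite subr_eq0 => /eqP.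
Qed.

Lemma inner_x_eq0 u : V u -> ip u u = 0 -> u = (fun=> 0).
Proof.
move=> hu u0; apply: (L2_repr hV) => //.
have ui := space_mul_integrable hu hu.
have : (\int[mu]_(x in Om) `|(u x * u x)%:E| = 0)%E.
  under eq_integral do rewrite abse_EFin ger0_norm -?expr2 ?sqr_ge0//.
  have := u0; rewrite /inner_x /Rintegral => E.
  by rewrite -[LHS]fineK ?E//; exact: integrable_fin_num.
move=> /(ae_eq_integral_abs mu mOm (measurable_int _ ui)).
apply: filterS => x H Ox; have := H Ox => /= -[] /eqP.
by rewrite mulf_eq0 orbb => /eqP.
Qed.

Definition orthonormal m (phi : 'I_m -> R -> R) :=
  (forall i, V (phi i)) /\ forall i j, ip (phi i) (phi j) = (i == j)%:R.

(** [V] lies in the span of [n] functions, and orthonormal families are free. *)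
Lemma orthonormal_bounded : exists n, forall m (phi : 'I_m -> R -> R),
  orthonormal phi -> (m <= n)%N.
Proof.
have [n [psi psiP]] := L2_fin hV; exists n => m phi [phiV phiO].
rewrite leqNgt; apply/negP => nm.
have /choice[c cE] : forall i, exists c : 'I_n -> R,
  phi i = (fun x => \sum_(k < n) c k * psi k x) by move=> i; exact: psiP.
pose C := \matrix_(i < m, k < n) c i k.
have : kermx C != 0.
  rewrite kermx_eq0 -row_leq_rank -ltnNge.
  exact: leq_ltn_trans (rank_leq_col C) nm.
move=> /rowV0Pn[y /sub_kermxP yC] /eqP; apply; apply/rowP => j; rewrite mxE.
have : ip (fun x => \sum_i y 0 i * phi i x) (phi j) = y 0 j.
  rewrite inner_x_suml// (bigD1 j)//= phiO eqxx mulr1 big1 ?addr0// => i ij.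
  by rewrite phiO (negbTE ij) mulr0.
move=> <-.
suff -> : (fun x => \sum_i y 0 i * phi i x) = (fun=> 0).
  rewrite /inner_x; under eq_Rintegral do rewrite mul0r.
  by rewrite Rintegral_cst// mul0r.
apply/funext => x.
transitivity (\sum_i \sum_k y 0 i * c i k * psi k x).
  apply: eq_bigr => i _; rewrite cE mulr_sumr.
  by apply: eq_bigr => k _; rewrite mulrA.
rewrite exchange_big big1// => k _; rewrite -mulr_suml.
rewrite (_ : \sum_i _ = 0) ?mul0r//.
have /rowP/(_ k) := yC; rewrite !mxE => H.
by rewrite -[RHS]H; apply: eq_bigr => i _; rewrite mxE.
Qed.

(** An orthonormal family of maximal size spans [V]: the remainder of a
    projection onto it would otherwise enlarge it. *)
Lemma orthonormal_basis : exists m (phi : 'I_m -> R -> R), orthonormal phi /\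
  forall u, V u -> u = (fun x => \sum_i ip u (phi i) * phi i x).
Proof.
have [n bound] := orthonormal_bounded.
pose P m := `[< exists phi : 'I_m -> R -> R, orthonormal phi >].
have exP : exists m, P m.
  exists 0%N; apply/asboolP; exists (fun _ _ => 0).
  by split=> [[]|[]].
have Pn m : P m -> (m <= n)%N by move=> /asboolP[phi /bound].
case: (ex_maxnP exP Pn) => m /asboolP[phi phiO] maxm.
exists m, phi; split=> // u hu; have [phiV phiE] := phiO.
pose r x := u x - \sum_i ip u (phi i) * phi i x.
have rV : V r by apply: spaceB => //; exact: space_sum.
have rphi j : ip r (phi j) = 0.
  rewrite inner_xB ?inner_x_suml//; last exact: space_sum.
  rewrite (bigD1 j)//= phiE eqxx mulr1 big1 ?addr0 ?subrr// => i ij.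
  by rewrite phiE (negbTE ij) mulr0.
have [r0|r0] := eqVneq (ip r r) 0.
  have := inner_x_eq0 rV r0 => /funeqP E; apply/funext => x.
  by have := E x => /eqP; rewrite subr_eq0 => /eqP.
have rr : 0 < ip r r by rewrite lt0r r0 inner_x_ge0.
(* otherwise the normalised remainder would extend the maximal family *)
suff /maxm : P m.+1 by rewrite ltnn.
apply/asboolP.
pose s := (Num.sqrt (ip r r))^-1.
exists (fun i => if unlift ord0 i is Some j then phi j else fun x => s * r x).
split=> [i|i j].
  by case: unliftP => [j _|_] //; exact: spaceZ.
have srV : V (fun x => s * r x) by exact: spaceZ.
have sphi j' : ip (fun x => s * r x) (phi j') = 0 by rewrite inner_xZ// rphi mulr0.
case: (unliftP ord0 i) => [i' ->|->]; case: (unliftP ord0 j) => [j' ->|->].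
- by rewrite phiE (inj_eq (lift_inj (h := ord0))).
- by rewrite inner_xC sphi.
- by rewrite sphi.
- rewrite inner_xZ// inner_xC inner_xZ// eqxx mulrA -expr2 exprVn sqr_sqrtr ?ltW//.
  by rewrite mulVf.
Qed.

End DiscreteSpace.

(** * Skew matrices *)

Local Open Scope sesquilinear_scope.

Section Skew.
Context {R : realType}.
Local Notation C := R[i].

Definition sqnorm m (w : 'cV[R]_m) : R := \sum_i w i 0 ^+ 2.

Let csqnorm m (w : 'cV[C]_m) : C := \sum_i `|w i 0| ^+ 2.

Let csqnormE m (w : 'cV[C]_m) : csqnorm w = (w ^t* *m w) 0 0.
Proof. by rewrite mxE; apply: eq_bigr => i _; rewrite !mxE normCK mulrC. Qed.

Let csqnorm_unitary m (P : 'M[C]_m) (w : 'cV[C]_m) : P \is unitarymx ->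
  csqnorm (P *m w) = csqnorm w.
Proof.
rewrite -trmxC_unitary => /unitarymxP; rewrite trmxCK => PP.
by rewrite !csqnormE trmx_mul map_mxM mulmxA -(mulmxA _ _ P) PP mulmx1.
Qed.

Let csqnorm_real m (w : 'cV[R]_m) :
  csqnorm (map_mx (real_complex R) w) = (sqnorm w)%:C%C.
Proof.
rewrite /csqnorm /sqnorm rmorph_sum; apply: eq_bigr => i _.
rewrite mxE rmorphXn /= normc_def /= expr0n /= addr0.
by rewrite -rmorphXn /= sqr_sqrtr ?sqr_ge0 // rmorphXn.
Qed.

(** A skew real matrix is normal, hence unitarily diagonalisable over the complex
    numbers; in such a basis the bound on the eigenvalues is a bound on the
    operator norm. *)
Lemma skew_contraction m (K : 'M[R]_m) (rho : R) : K^T = - K ->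
  (forall (l : C) (z : 'cV[C]_m), z != 0 ->
     map_mx (real_complex R) K *m z = l *: z -> `|l| ^+ 2 <= (rho ^+ 2)%:C%C) ->
  forall w, sqnorm (K *m w) <= rho ^+ 2 * sqnorm w.
Proof.
move=> Kskew spec w; set A := map_mx _ K in spec *.
have AtC : A ^t* = - A.
  apply/matrixP => i j; rewrite !mxE.
  have /matrixP/(_ i j) := Kskew; rewrite !mxE => ->.
  apply: (etrans (conjc_real (- K i j))); exact: raddfN.
have /orthomx_spectralP : A \is normalmx.
  by apply/normalmxP; rewrite AtC mulmxN mulNmx.
set P := spectralmx A; set d := spectral_diag A => AE.
have PU : P \is unitarymx by exact: spectral_unitarymx.
have PA : P *m A = diag_mx d *m P.
  by rewrite {1}AE -mulmxA mulKVmx ?unitarymx_unit.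
have AP : A *m P ^t* = P ^t* *m diag_mx d.
  by rewrite {1}AE -invmx_unitary// mulmxK ?unitarymx_unit.
have dle i : `|d 0 i| ^+ 2 <= (rho ^+ 2)%:C%C.
  pose z : 'cV[C]_m := delta_mx i 0.
  apply: (spec _ (P ^t* *m z)).
    apply/eqP => /(congr1 (mulmx P)); rewrite mulmxA (unitarymxP PU) mul1mx mulmx0.
    by move=> /colP/(_ i)/eqP; rewrite !mxE !eqxx oner_eq0.
  rewrite mulmxA AP -mulmxA scalemxAr; congr (_ *m _).
  apply/colP => j; rewrite mul_diag_mx !mxE.
  by case: eqP => [->|_] //=; rewrite !mulr0.
rewrite -lecR rmorphM /= -!csqnorm_real map_mxM -/A.
rewrite -(csqnorm_unitary (A *m _) PU) mulmxA PA -mulmxA.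
rewrite -(csqnorm_unitary (map_mx _ w) PU) mulr_sumr; apply: ler_sum => i _.
rewrite mul_diag_mx mxE normrM exprMn; exact: ler_wpM2r.
Qed.

Lemma sqnorm_ge0 m (w : 'cV[R]_m) : 0 <= sqnorm w.
Proof. by apply: sumr_ge0 => i _; rewrite sqr_ge0. Qed.

Lemma sqnorm_eq0 m (w : 'cV[R]_m) : sqnorm w = 0 -> w = 0.
Proof.
move=> /psumr_eq0P H; apply/colP => i; rewrite mxE.
by apply/eqP; rewrite -sqrf_eq0 H// => j _; rewrite sqr_ge0.
Qed.

Definition dot m (w z : 'cV[R]_m) : R := \sum_i w i 0 * z i 0.

Lemma dot_mxE m (w z : 'cV[R]_m) : dot w z = (w^T *m z) 0 0.
Proof. by rewrite mxE; apply: eq_bigr => i _; rewrite mxE. Qed.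

Lemma dot_skew m (K : 'M[R]_m) w : K^T = - K -> dot w (K *m w) = 0.
Proof.
move=> Kskew; have : dot w (K *m w) = - dot w (K *m w).
  transitivity ((w^T *m (K *m w))^T 0 0); first by rewrite mxE dot_mxE.
  by rewrite dot_mxE !trmx_mul trmxK Kskew mulmxN mulNmx mulmxA mxE.
lra.
Qed.

Lemma sqnorm_shift_skew m (K : 'M[R]_m) s w : K^T = - K ->
  sqnorm (w + s *: (K *m w)) = sqnorm w + s ^+ 2 * sqnorm (K *m w).
Proof.
move=> /(dot_skew w) K0.
transitivity (sqnorm w + 2 * s * dot w (K *m w) + s ^+ 2 * sqnorm (K *m w)).
  rewrite /sqnorm /dot !mulr_sumr -!big_split /=; apply: eq_bigr => i _.
  by rewrite !mxE; ring.
by rewrite K0 mulr0 addr0.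
Qed.

(** With [w = (1 + s K)^-1 p] the equation says [d = - t K w], while
    [|p|^2 = |w|^2 + s^2 |K w|^2]; so the claim reduces to
    [|K w|^2 <= rho^2 |w|^2]. *)
Lemma skew_resolvent_bound m (K : 'M[R]_m) (rho s t : R) (d p : 'cV[R]_m) :
  K^T = - K -> (forall w, sqnorm (K *m w) <= rho ^+ 2 * sqnorm w) ->
  d + s *: (K *m d) = - (t *: (K *m p)) ->
  (1 + s ^+ 2 * rho ^+ 2) * sqnorm d <= t ^+ 2 * rho ^+ 2 * sqnorm p.
Proof.
move=> Kskew Kle dE; pose B := 1%:M + s *: K.
have BE w : B *m w = w + s *: (K *m w) by rewrite mulmxDl mul1mx scalemxAl.
have Binj (w : 'cV[R]_m) : B *m w = 0 -> w = 0.
  move=> Bw; have := congr1 (@sqnorm m) Bw; rewrite BE sqnorm_shift_skew//.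
  rewrite [RHS]big1; last by move=> i _; rewrite mxE expr0n.
  move=> H; apply: sqnorm_eq0; have := sqnorm_ge0 w; have := sqnorm_ge0 (K *m w).
  by have := sqr_ge0 s; nra.
have Bu : B \in unitmx.
  rewrite -unitmx_tr -row_free_unit -kermx_eq0; apply/negPn/negP.
  move=> /rowV0Pn[y /sub_kermxP yB /eqP]; apply.
  apply: (can_inj (@trmxK _ _ _)); rewrite trmx0; apply: Binj.
  by apply: (can_inj (@trmxK _ _ _)); rewrite trmx_mul trmxK yB trmx0.
(* B is invertible since |B w| >= |w| *)
pose w := invmx B *m p.
have pE : p = w + s *: (K *m w) by rewrite -BE mulKVmx.
have {dE}dE : d = - (t *: (K *m w)).
  apply/eqP; rewrite -subr_eq0; apply/eqP/Binj.
  rewrite mulmxBr !BE dE {1}pE; apply/colP => i.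
  rewrite !mulmxDr !mulmxN -!scalemxAr !mxE; ring.
have -> : sqnorm d = t ^+ 2 * sqnorm (K *m w).
  by rewrite dE /sqnorm mulr_sumr; apply: eq_bigr => i _; rewrite !mxE; ring.
rewrite pE sqnorm_shift_skew//.
by have := Kle w; have := sqr_ge0 t; nra.
Qed.

Lemma skew_resolvent_boundB m (K : 'M[R]_m) (rho s t : R) (x y z p q : 'cV[R]_m) :
  K^T = - K -> (forall w, sqnorm (K *m w) <= rho ^+ 2 * sqnorm w) ->
  x + s *: (K *m x) = z - t *: (K *m p) ->
  y + s *: (K *m y) = z - t *: (K *m q) ->
  (1 + s ^+ 2 * rho ^+ 2) * sqnorm (x - y) <= t ^+ 2 * rho ^+ 2 * sqnorm (p - q).
Proof.
move=> Kskew Kle xE yE; apply: (skew_resolvent_bound Kskew Kle).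
rewrite !mulmxBr !scalerBr addrACA -opprD xE yE opprD addrACA subrr add0r.
by rewrite opprB opprK addrC.
Qed.

Lemma young_dot m (d w : 'cV[R]_m) (delta : R) : 0 < delta ->
  dot d w <= delta / 2 * sqnorm w + (2 * delta)^-1 * sqnorm d.
Proof.
move=> d0; rewrite /dot /sqnorm !mulr_sumr -big_split; apply: ler_sum => i _ /=.
move: (d i 0) (w i 0) => x y.
rewrite -subr_ge0 (_ : _ - _ = (2 * delta)^-1 * (delta * y - x) ^+ 2).
  by rewrite mulr_ge0 ?sqr_ge0// invr_ge0 mulr_ge0// ltW.
by field; rewrite gt_eqF.
Qed.

Lemma affine_eqB m (K : 'M[R]_m) (r s : R) (x y z x' y' : 'cV[R]_m) :
  r *: x + s *: (K *m x) = z + y -> r *: x' + s *: (K *m x') = z + y' ->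
  r *: (x - x') + s *: (K *m (x - x')) = y - y'.
Proof.
move=> E E'; rewrite mulmxBr !scalerBr addrACA -opprD E E'.
by rewrite opprD addrACA subrr add0r.
Qed.

End Skew.

(** * Coordinates *)

Section Tonelli.
Context {R : realType}.
Local Notation mu := (@lebesgue_measure R).

(** The partial integral is the difference of the Tonelli integrals of the positive
    and negative parts. *)
Lemma measurable_partial_integral (G : R * R -> \bar R) :
  measurable_fun setT G ->
  measurable_fun setT (fun v => \int[mu]_x G (x, v))%E.
Proof.
move=> mG.
have -> : (fun v => \int[mu]_x G (x, v))%E =
    (fun v => \int[mu]_x G^\+ (x, v) - \int[mu]_x G^\- (x, v))%E.
  apply/funext => v; rewrite integralE; congr (_ - _)%E; apply: eq_integral => x _.
    by rewrite !funeposE.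
  by rewrite !funenegE.
have half (H : measurableTypeR R * measurableTypeR R -> \bar R) :
    measurable_fun setT H -> (forall p, 0 <= H p)%E ->
    measurable_fun setT (fun v : measurableTypeR R => \int[mu]_x H (x, v))%E.
  by move=> mH H0; exact: (measurable_fun_fubini_tonelli_G (m1 := mu) H mH H0).
apply: emeasurable_funB.
- exact: (half _ (measurable_funepos mG) (fun p => funepos_ge0 G p)).
- exact: (half _ (measurable_funeneg mG) (fun p => funeneg_ge0 G p)).
Qed.

End Tonelli.

Section Coordinates.
Context {R : realType}.
Local Notation mu := (@lebesgue_measure R).
Variables (a b : R) (V : set (R -> R)).
Hypothesis hV : L2_findim a b V.
Local Notation Om := (Omega_x a b).
Local Notation ip := (inner_x a b).
Variables (m : nat) (phi : 'I_m -> R -> R).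
Hypothesis phi_on : orthonormal a b V phi.
Hypothesis phi_gen : forall u, V u -> u = (fun x => \sum_i ip u (phi i) * phi i x).

Let phiV := phi_on.1.
Let phiE := phi_on.2.
Let mOm : measurable (Om : set (measurableTypeR R)) := measurable_Omega a b.

Definition combine (c : 'cV[R]_m) : R -> R := fun x => \sum_i c i 0 * phi i x.
Definition coords (u : R -> R) : 'cV[R]_m := \col_i ip u (phi i).

Lemma combine_space c : V (combine c).
Proof. exact: (space_sum hV _ (fun i => c i 0) phiV). Qed.

Lemma combine_coords u : V u -> combine (coords u) = u.
Proof.
move=> uV; rewrite [RHS](phi_gen uV); apply/funext => x; apply: eq_bigr => i _.
by rewrite mxE.
Qed.

Lemma coords_combine c : coords (combine c) = c.
Proof.
apply/colP => j; rewrite mxE (inner_x_suml hV)// (bigD1 j)//= phiE eqxx mulr1.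
by rewrite big1 ?addr0// => i ij; rewrite phiE (negbTE ij) mulr0.
Qed.

Lemma combine_inj c d : (forall x, Om x -> combine c x = combine d x) -> c = d.
Proof.
move=> /(space_eqP hV (combine_space c) (combine_space d)) E.
by rewrite -[c]coords_combine E coords_combine.
Qed.

Lemma combineD c d x : combine (c + d) x = combine c x + combine d x.
Proof. by rewrite -big_split; apply: eq_bigr => i _; rewrite mxE mulrDl. Qed.

Lemma combineZ k c x : combine (k *: c) x = k * combine c x.
Proof. by rewrite mulr_sumr; apply: eq_bigr => i _; rewrite mxE mulrA. Qed.

Lemma combineB c d x : combine (c - d) x = combine c x - combine d x.
Proof. by rewrite combineD -scaleN1r combineZ mulN1r. Qed.

Lemma inner_combine c d : ip (combine c) (combine d) = dot c d.
Proof.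
rewrite (inner_x_suml hV)//; last exact: combine_space.
apply: eq_bigr => i _; congr (_ * _); rewrite inner_xC.
by have /colP/(_ i) := coords_combine d; rewrite mxE.
Qed.

Section Operator.
Variable A : (R -> R) -> R -> R.
Hypothesis hA : linear_operator V A.

Definition operator_mx : 'M[R]_m := \matrix_(i, j) ip (A (phi j)) (phi i).
Local Notation K := operator_mx.

Lemma operator_sum (c : 'I_m -> R) :
  A (fun x => \sum_i c i * phi i x) = (fun x => \sum_i c i * A (phi i) x).
Proof.
suff H : forall s : seq 'I_m, A (fun x => \sum_(i <- s) c i * phi i x) =
  (fun x => \sum_(i <- s) c i * A (phi i) x) by exact: H.
have lin := hA.2.
have A0 : A (fun=> 0) = (fun=> 0).
  have := lin (- 1) _ _ (L2_zero hV) (L2_zero hV).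
  rewrite (_ : (fun _ => -1 * 0 + 0) = (fun=> 0 : R)); last first.
    by apply/funext => x; ring.
  move=> /funeqP E; apply/funext => x; have := E x; rewrite /=; lra.
elim=> [|i s IH].
  rewrite (_ : (fun x => _) = (fun=> 0)); last first.
    by apply/funext => x; rewrite big_nil.
  by rewrite A0; apply/funext => x; rewrite big_nil.
rewrite (_ : (fun x => _) = (fun x => c i * phi i x + \sum_(j <- s) c j * phi j x)).
  rewrite lin//; last exact: (space_sum hV _ _ phiV).
  by rewrite IH; apply/funext => x; rewrite big_cons.
by apply/funext => x; rewrite big_cons.
Qed.

Lemma operator_combine c : A (combine c) = combine (K *m c).
Proof.
rewrite operator_sum; apply/funext => x.
transitivity (\sum_j \sum_i K i j * c j 0 * phi i x).
  apply: eq_bigr => j _; rewrite {1}(phi_gen (hA.1 _ (phiV j))) mulr_sumr.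
  by apply: eq_bigr => i _; rewrite mxE; ring.
rewrite exchange_big; apply: eq_bigr => i _.
by rewrite mxE mulr_suml.
Qed.

Lemma operator_mx_skew : skew_symmetric a b V A -> K^T = - K.
Proof.
move=> skew; apply/matrixP => i j; rewrite !mxE.
by rewrite skew// inner_xC.
Qed.

(** The real and imaginary parts of a complex eigenvector are the coordinates of
    the real and imaginary parts of an eigenfunction. *)
Lemma operator_mx_eigenvalue (l : R[i]) (z : 'cV[R[i]]_m) : z != 0 ->
  map_mx (real_complex R) K *m z = l *: z -> is_eigenvalue V A l.
Proof.
move=> z0 Kz; pose zr : 'cV[R]_m := map_mx (@complex.Re R) z.
pose zi : 'cV[R]_m := map_mx (@complex.Im R) z.
have KzE i : ((K *m zr) i 0 +i* (K *m zi) i 0)%C = l * z i 0.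
  have /colP/(_ i) := Kz; rewrite [RHS]mxE => <-; rewrite !mxE.

  apply/eqP; rewrite eq_complex /=; apply/andP; split; apply/eqP.
    rewrite (raddf_sum (@complex.Re R)); apply: eq_bigr => j _.
    by rewrite !mxE; case: (z j 0) => x y /=; ring.
  rewrite (raddf_sum (@complex.Im R)); apply: eq_bigr => j _.
  by rewrite !mxE; case: (z j 0) => x y /=; ring.
exists (fun x => (combine zr x +i* combine zi x)%C); split.
- exact: combine_space.
- exact: combine_space.
- move=> Z0; move/eqP: z0; apply.
  have zr0 : zr = 0.
    apply: combine_inj => x _; have /funeqP/(_ x) := Z0 => -[-> _].
    by rewrite /combine big1// => i _; rewrite mxE mul0r.
  have zi0 : zi = 0.
    apply: combine_inj => x _; have /funeqP/(_ x) := Z0 => -[_ ->].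
    by rewrite /combine big1// => i _; rewrite mxE mul0r.
  apply/colP => i; have /colP/(_ i) := zr0; have /colP/(_ i) := zi0.
  by rewrite !mxE; case: (z i 0) => x y /= -> ->.
apply/funext => x; rewrite /complexification.
have -> : Re_fun (fun x => (combine zr x +i* combine zi x)%C) = combine zr by [].
have -> : Im_fun (fun x => (combine zr x +i* combine zi x)%C) = combine zi by [].
rewrite !operator_combine.
have [lr [li lE]] : exists lr li, l = (lr +i* li)%C 
  by case: l {Kz KzE} => lr li; exists lr, li.
have Kr : K *m zr = lr *: zr - li *: zi.
  apply/colP => i; have := KzE i; rewrite lE !mxE.
  by case: (z i 0) => p q [] /= -> _.
have Ki : K *m zi = lr *: zi + li *: zr.
  apply/colP => i; have := KzE i; rewrite lE !mxE.
  by case: (z i 0) => p q [] /= _ ->.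
rewrite Kr Ki combineB combineD !combineZ lE.
by apply/eqP; rewrite eq_complex /= !eqxx.
Qed.

Lemma operator_mx_le (h : R) : 0 < h -> skew_symmetric a b V A ->
  imaginary_spectrum V A h ->
  forall w, sqnorm (K *m w) <= h^-1 ^+ 2 * sqnorm w.
Proof.
move=> h0 skew spec; apply: skew_contraction; first exact: operator_mx_skew.
move=> l z z0 /(operator_mx_eigenvalue z0) /spec[y [-> yh]].
rewrite normc_def /= expr0n /= add0r -rmorphXn /= lecR.
rewrite sqr_sqrtr ?sqr_ge0// -real_normK ?num_real//.
by rewrite ler_sqr ?nnegrE ?invr_ge0// ltW.
Qed.

End Operator.

Section Kinetic.
Variables (u0 theta0 : R).
Hypothesis theta0_gt0 : 0 < theta0.
Local Notation M := (maxwellian u0 theta0).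
Local Notation weighted_L2 := (weighted_L2 u0 theta0).
Implicit Types (c d : R -> 'cV[R]_m) (f g : R -> R -> R).

(** [c v] collects the coordinates of [f] at velocity [v]; this is the form in
    which the kinetic functions enter the estimates. *)
Definition expands c f : Prop :=
  (forall x v, f x v = combine (c v) x) /\ forall i, weighted_L2 (fun v => c v i 0).

Let measurable_strip : measurable (Om `*` setT : set (R * R)).
Proof. by apply: measurableX => //; exact: mOm. Qed.

Let measurable_pullback_x (u : R -> R) : measurable_fun Om u ->
  measurable_fun (Om `*` setT) (fun p : R * R => u p.1).
Proof.
move=> mu_; apply: (measurable_comp (F := Om) (f := u) (g := fst)) => //.
- by move=> _ [p [? _]] <-.
- exact: measurable_funTS.
Qed.

Let measurable_pullback_v (w : R -> R) : measurable_fun setT w ->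
  measurable_fun (Om `*` setT) (fun p : R * R => w p.2).
Proof.
move=> mw; apply: measurable_funTS; exact: measurableT_comp.
Qed.

Let measurable_weight : measurable_fun setT (fun v => (M v)^-1).
Proof. exact: measurable_inv_maxwellian. Qed.

(** A coordinate is a partial integral in [x] of a jointly measurable function,
    so it is measurable in [v]. *)
Lemma measurable_coords f i : (forall v, V (fun x => f x v)) ->
  measurable_fun (Om `*` setT) (fun p : R * R => f p.1 p.2) ->
  measurable_fun setT (fun v => coords (fun x => f x v) i 0).
Proof.
move=> fV mf.
pose G := (EFin \o (fun p : R * R => f p.1 p.2 * phi i p.1)) \_ (Om `*` setT).
have mG : measurable_fun setT G.
  apply/(measurable_restrictT _ measurable_strip)/measurable_EFinP.
  apply: measurable_funM => //.
  exact: (measurable_pullback_x (space_measurable hV (phiV i))).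
have := measurable_partial_integral mG.
move=> /(measurableT_comp (@fine_measurable R _ measurableT)).
apply: eq_measurable_fun => v _ /=.
rewrite mxE /inner_x /Rintegral [in RHS]integral_mkcond; congr fine.
apply: eq_integral => x _; rewrite /G !patchE in_setX in_setT andbT.
by case: ifP.
Qed.

(** Tonelli, integrating in [x] first, where the basis is orthonormal. *)
Lemma strip_integral_combine c : (forall i, measurable_fun setT (fun v => c v i 0)) ->
  (\int[mu \x mu]_(p in Om `*` setT)
     ((combine (c p.2) p.1) ^+ 2 * (M p.2)^-1)%:E =
   \int[mu]_v (sqnorm (c v) * (M v)^-1)%:E)%E.
Proof.
move=> mc; rewrite integral_mkcond.
have M0 v : 0 <= (M v)^-1 by rewrite invr_ge0 ltW// maxwellian_gt0.
pose G := (EFin \o (fun p : R * R => (combine (c p.2) p.1) ^+ 2 * (M p.2)^-1))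
  \_ (Om `*` setT).
have mG : measurable_fun setT G.
  apply/(measurable_restrictT _ measurable_strip)/measurable_EFinP.
  apply: measurable_funM; last exact: (measurable_pullback_v measurable_weight).
  apply: measurable_funX; apply: measurable_sum => i.
  apply: measurable_funM; first exact: (measurable_pullback_v (mc i)).
  exact: (measurable_pullback_x (space_measurable hV (phiV i))).
have G0 p : (0 <= G p)%E.
  rewrite /G patchE; case: ifP => // _.
  by rewrite lee_fin mulr_ge0 ?sqr_ge0.
apply: (etrans (fubini_tonelli2 (m1 := mu) (m2 := mu) _ mG G0)).
apply: eq_integral => v _; rewrite /fubini_G.
have VV := space_mul_integrable hV (combine_space (c v)) (combine_space (c v)).
transitivity (\int[mu]_(x in Om) ((combine (c v) x * combine (c v) x)%:E * (M v)^-1%:E))%E.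
  rewrite [RHS]integral_mkcond; apply: eq_integral => x _.
  by rewrite /G !patchE in_setX in_setT andbT /= expr2 EFinM.
rewrite (integralZr mOm VV) EFinM; congr (_ * _)%E.
transitivity (ip (combine (c v)) (combine (c v)))%:E.
  by rewrite /inner_x /Rintegral fineK//; exact: integrable_fin_num.
by rewrite inner_combine.
Qed.

Lemma norm_M_expands c f : expands c f ->
  norm_M a b u0 theta0 f ^+ 2 = \sum_i energy u0 theta0 (fun v => c v i 0).
Proof.
move=> [fE cL].
rewrite /norm_M; have ci i := (cL i).2.
have -> : inner_M a b u0 theta0 f f = \sum_i energy u0 theta0 (fun v => c v i 0).
  rewrite /energy -(Rintegral_sum measurableT ci) /inner_M /Rintegral.
  congr fine.
  transitivity (\int[mu \x mu]_(p in Om `*` setT)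
     ((combine (c p.2) p.1) ^+ 2 * (M p.2)^-1)%:E)%E.
    by apply: eq_integral => p _; rewrite fE expr2.
  rewrite strip_integral_combine; last by move=> i; exact: (cL i).1.
  by apply: eq_integral => v _; rewrite /sqnorm mulr_suml.
rewrite sqr_sqrtr//; apply: sumr_ge0 => i _; exact: energy_ge0.
Qed.

Lemma kinetic_expands f : kinetic_space a b u0 theta0 V f ->
  expands (fun v => coords (fun x => f x v)) f.
Proof.
move=> [fV [mf fi]].
have mc i := measurable_coords i fV mf.
split=> [x v|i]; first by rewrite combine_coords.
split; first exact: mc.
have M0 v : 0 <= (M v)^-1 by rewrite invr_ge0 ltW// maxwellian_gt0.
apply/integrableP; split.
  apply/measurable_EFinP; apply: measurable_funM => //.
  by apply: measurable_funX; exact: mc.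
apply: le_lt_trans fi.
rewrite [leRHS](_ : _ = \int[mu \x mu]_(p in Om `*` setT)
     ((combine (coords (fun x => f x p.2)) p.1) ^+ 2 * (M p.2)^-1)%:E)%E; last first.
  by apply: eq_integral => p _; rewrite combine_coords.
rewrite (strip_integral_combine mc).
apply: ge0_le_integral => //.
- apply: measurableT_comp => //; apply/measurable_EFinP.
  by apply: measurable_funM => //; apply: measurable_funX; exact: mc.
- apply/measurable_EFinP; apply: measurable_funM => //.
  by apply: measurable_sum => j; apply: measurable_funX; exact: mc.
move=> v _; rewrite lee_fin ger0_norm; last by rewrite mulr_ge0 ?M0// sqr_ge0.
apply: ler_wpM2r => //; rewrite /sqnorm (bigD1 i)//= lerDl.
by apply: sumr_ge0 => j _; rewrite sqr_ge0.
Qed.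

Lemma expandsB c d f g : expands c f -> expands d g ->
  expands (fun v => c v - d v) (fun x v => f x v - g x v).
Proof.
move=> [fE cL] [gE dL]; split=> [x v|i]; first by rewrite fE gE combineB.
have := weighted_L2B theta0_gt0 (cL i) (dL i); congr (weighted_L2 _).
by apply/funext => v; rewrite !mxE.
Qed.

Definition massv c : 'cV[R]_m := \col_i mass (fun v => c v i 0).
Definition fluxv c : 'cV[R]_m := \col_i flux u0 theta0 (fun v => c v i 0).

Lemma fluxvB c d f g : expands c f -> expands d g ->
  fluxv (fun v => c v - d v) = fluxv c - fluxv d.
Proof.
move=> [_ cL] [_ dL]; apply/colP => i; rewrite !mxE -fluxB//.
by congr flux; apply/funext => v; rewrite !mxE.
Qed.

Lemma expands_Rintegral c (w : R -> R) x :
  (forall i, mu.-integrable setT (EFin \o (fun v => w v * c v i 0))) ->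
  \int[mu]_v (w v * combine (c v) x) =
  \sum_i (\int[mu]_v (w v * c v i 0)) * phi i x.
Proof.
move=> wc.
transitivity (\int[mu]_v \sum_i (phi i x * (w v * c v i 0))).
  apply: eq_Rintegral => v _; rewrite mulr_sumr.
  by apply: eq_bigr => i _; ring.
rewrite Rintegral_sum//; last by move=> i; exact: RintegrableZ.
by apply: eq_bigr => i _; rewrite RintegralZl// mulrC.
Qed.

Lemma density_expands c f : expands c f -> density f = combine (massv c).
Proof.
move=> [fE cL]; apply/funext => x; rewrite /density /avg_v.
transitivity (\int[mu]_v (1 * combine (c v) x)).
  by apply: eq_Rintegral => v _; rewrite fE mul1r.
rewrite expands_Rintegral => [|i].
  apply: eq_bigr => i _; rewrite mxE; congr (_ * _).
  by apply: eq_Rintegral => v _; rewrite mul1r.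
apply: (eq_Rintegrable (weighted_L2_integrable theta0_gt0 (cL i))) => v.
by rewrite mul1r.
Qed.

Lemma proj_expands c f : expands c f ->
  expands (fun v => M v *: massv c) (proj_M u0 theta0 f).
Proof.
move=> fc; split=> [x v|i].
  by rewrite /proj_M (density_expands fc) combineZ.
have := weighted_L2Z theta0_gt0 (massv c i 0) (weighted_L2_maxwellian u0 theta0_gt0).
by congr (weighted_L2 _); apply/funext => v; rewrite [RHS]mxE mulrC.
Qed.

Lemma proj_perp_expands c f : expands c f ->
  expands (fun v => c v - M v *: massv c) (proj_M_perp u0 theta0 f).
Proof. by move=> fc; apply: expandsB => //; exact: proj_expands. Qed.

Lemma micro_coords c i :
  (fun v => (c v - M v *: massv c) i 0) = micro u0 theta0 (fun v => c v i 0).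
Proof. by apply/funext => v; rewrite !mxE. Qed.

Lemma moment_flux_expands c f : expands c f ->
  moment_flux u0 theta0 f = combine (fluxv c).
Proof.
move=> fc; have [gE gL] := proj_perp_expands fc.
apply/funext => x; rewrite /moment_flux /avg_v.
transitivity (\int[mu]_v (v * combine (c v - M v *: massv c) x)).
  by apply: eq_Rintegral => v _; rewrite -gE.
rewrite expands_Rintegral => [|i].
  apply: eq_bigr => i _; congr (_ * _).
  by rewrite [RHS]mxE /flux -micro_coords.
exact: (weighted_L2_moment_integrable theta0_gt0 (gL i)).
Qed.

End Kinetic.
End Coordinates.

(** * The kinetic and low order steps in coordinates *)

Section LebesgueAlmostEverywhere.
Context {R : realType}.
Local Notation mu := (@lebesgue_measure R).
Implicit Types p q r : R -> Prop.

Lemma lebesgue_ae_mono2 p q r : (forall v, p v -> q v -> r v) ->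
  {ae mu, forall v, p v} -> {ae mu, forall v, q v} -> {ae mu, forall v, r v}.
Proof.
have F := @ae_filter_ringOfSetsType _ _ R (@lebesgue_measure R).
move=> pqr; exact: (@filterS2 _ _ F p q r pqr).
Qed.

Lemma lebesgue_ae_mono p q : (forall v, p v -> q v) ->
  {ae mu, forall v, p v} -> {ae mu, forall v, q v}.
Proof. by move=> pq hp; apply: (lebesgue_ae_mono2 _ hp hp) => v /pq. Qed.

End LebesgueAlmostEverywhere.

Section Scheme.
Context {R : realType}.
Local Notation mu := (@lebesgue_measure R).
Variables (a b : R) (V : set (R -> R)).
Hypothesis hV : L2_findim a b V.
Variables (m : nat) (phi : 'I_m -> R -> R).
Hypothesis phi_on : orthonormal a b V phi.
Hypothesis phi_gen : forall u, V u ->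
  u = (fun x => \sum_i inner_x a b u (phi i) * phi i x).
Variable A : (R -> R) -> R -> R.
Hypothesis hA : linear_operator V A.
Variables (u0 theta0 : R).
Hypothesis theta0_gt0 : 0 < theta0.
Local Notation M := (maxwellian u0 theta0).
Local Notation K := (operator_mx a b phi A).
Local Notation combine := (combine phi).
Local Notation coords := (coords a b phi).
Local Notation expands := (expands phi u0 theta0).
Local Notation fluxv := (fluxv u0 theta0).
Variables (nu dt : R).
Implicit Types (c d : R -> 'cV[R]_m) (f g : R -> R -> R).

Let A_combine := operator_combine hV phi_on phi_gen hA.

Lemma kinetic_step_coords ck c fk g (n : R -> R) :
  expands ck fk -> expands c g -> V n ->
  kinetic_step a b u0 theta0 nu dt A fk n g ->
  {ae mu, forall v, (1 + nu * dt) *: c v + (dt * v) *: (K *m c v) =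
     ck v + (nu * dt * M v) *: coords n}.
Proof.
move=> [fkE _] [gE _] nV ae_step; apply: lebesgue_ae_mono ae_step => v step.
apply: (combine_inj hV phi_on) => x /step.
rewrite /apply_x (_ : (fun y => g y v) = combine (c v)); last first.
  by apply/funext => y; rewrite gE.
rewrite A_combine gE fkE !combineD !combineZ (combine_coords phi_gen nV) => E.
by refine (etrans _ (etrans E _)); ring.
Qed.

Lemma low_order_step_coords ck c fk f (n : R -> R) :
  expands ck fk -> expands c f -> V n ->
  low_order_step a b u0 theta0 dt A fk f n ->
  coords n + (u0 * dt) *: (K *m coords n) =
    massv ck - dt *: (K *m fluxv c).
Proof.
move=> fkE fE nV step; apply: (combine_inj hV phi_on) => x /step.
rewrite (density_expands theta0_gt0 fkE) (moment_flux_expands theta0_gt0 fE).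
rewrite -{1 2}(combine_coords phi_gen nV) !A_combine => E.
by rewrite combineD combineB !combineZ.
Qed.

(** Integration of the backward Euler equation in [v]: the two collision terms
    cancel, and the transport term splits by [moment_flux_mass]. *)
Lemma kinetic_step_moment ck c fk g :
  expands ck fk -> expands c g ->
  {ae mu, forall v, (1 + nu * dt) *: c v + (dt * v) *: (K *m c v) =
     ck v + (nu * dt * M v) *: massv c} ->
  massv c + (u0 * dt) *: (K *m massv c) = massv ck - dt *: (K *m fluxv c).
Proof.
move=> [_ ckL] [_ cL] step; apply/colP => i.
have ci j := weighted_L2_integrable theta0_gt0 (cL j).
have vci j := weighted_L2_moment_integrable theta0_gt0 (cL j).
have cki := weighted_L2_integrable theta0_gt0 (ckL i).
have Mi := integrable_maxwellian u0 theta0_gt0.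
have Kvi j : mu.-integrable setT (EFin \o (fun v => dt * K i j * (v * c v j 0))).
  exact: RintegrableZ.
pose l v := (1 + nu * dt) * c v i 0 + \sum_j dt * K i j * (v * c v j 0).
pose r v := ck v i 0 + nu * dt * massv c i 0 * M v.
have l1 := RintegrableZ measurableT (1 + nu * dt) (ci i).
have l2 := Rintegrable_sum measurableT Kvi.
have r2 := RintegrableZ measurableT (nu * dt * massv c i 0) Mi.
have lr : \int[mu]_v l v = \int[mu]_v r v.
  apply: ae_eq_Rintegral => //; [exact: RintegrableD..|].
  apply: lebesgue_ae_mono step => v /colP/(_ i) E _.
  move: E; rewrite !mxE /l /r !mxE => E.
  transitivity ((1 + nu * dt) * c v i 0 + dt * v * \sum_j K i j * c v j 0).
    by congr (_ + _); rewrite mulr_sumr; apply: eq_bigr => j _; ring.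
  rewrite (eq_bigr (fun j => (operator_mx a b phi A) i j * c v j 0)) // E; ring.
move: lr; rewrite /l /r.
rewrite (RintegralD measurableT l1 l2) (RintegralD measurableT cki r2).
rewrite (Rintegral_sum measurableT Kvi) (RintegralZl _ measurableT (ci i)).
rewrite (RintegralZl _ measurableT Mi) Rintegral_maxwellian//.
under eq_bigr do rewrite (RintegralZl _ measurableT (vci _))
  (moment_flux_mass theta0_gt0 (cL _)).
have mE j : mass (fun v => c v j 0) = massv c j 0 by rewrite mxE.
have fE j : flux u0 theta0 (fun v => c v j 0) = fluxv c j 0 by rewrite mxE.
rewrite -/(mass (fun v => c v i 0)) -/(mass (fun v => ck v i 0)) mE.
under eq_bigr do rewrite mE fE.
have -> : \sum_j dt * K i j * (u0 * massv c j 0 + fluxv c j 0) =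
    u0 * dt * (K *m massv c) i 0 + dt * (K *m fluxv c) i 0.
  by rewrite ![(_ *m _) i 0]mxE !mulr_sumr -big_split; apply: eq_bigr => j _ /=; ring.
have -> : mass (fun v => ck v i 0) = massv ck i 0 by rewrite mxE.
move: (K *m massv c) (K *m fluxv c) (massv c) (massv ck) => x y z t.
rewrite !mxE; lra.
Qed.

Lemma kinetic_step_error ck c d (x y : 'cV[R]_m) :
  {ae mu, forall v, (1 + nu * dt) *: c v + (dt * v) *: (K *m c v) =
     ck v + (nu * dt * M v) *: x} ->
  {ae mu, forall v, (1 + nu * dt) *: d v + (dt * v) *: (K *m d v) =
     ck v + (nu * dt * M v) *: y} ->
  {ae mu, forall v, (1 + nu * dt) *: (c v - d v) +
     (dt * v) *: (K *m (c v - d v)) = (nu * dt * M v) *: (x - y)}.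
Proof.
by apply: lebesgue_ae_mono2 => v E1 E2; rewrite (affine_eqB E1 E2) scalerBr.
Qed.

(** Pairing with [E / M]: the transport term drops out for each [v], by skewness.
    Working pointwise in [v] avoids any integrability of [v E . A E / M]. *)
Lemma kinetic_energy_identity E g (d : 'cV[R]_m) : K^T = - K -> expands E g ->
  {ae mu, forall v, (1 + nu * dt) *: E v + (dt * v) *: (K *m E v) =
     (nu * dt * M v) *: d} ->
  (1 + nu * dt) * \sum_i energy u0 theta0 (fun v => E v i 0) =
    nu * dt * dot d (massv E).
Proof.
move=> Kskew [_ EL] step.
have Ei j := weighted_L2_integrable theta0_gt0 (EL j).
have E2i j := (EL j).2.
rewrite /energy -(Rintegral_sum measurableT E2i).
have -> : dot d (massv E) = \int[mu]_v \sum_i d i 0 * E v i 0.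
  rewrite Rintegral_sum//; last by move=> i; exact: RintegrableZ.
  by apply: eq_bigr => i _; rewrite RintegralZl// mxE.
rewrite -!RintegralZl//; last 2 first.
- by apply: Rintegrable_sum => // i; exact: RintegrableZ.
- exact: Rintegrable_sum.
apply: ae_eq_Rintegral => //.
- by apply: RintegrableZ => //; exact: Rintegrable_sum.
- apply: RintegrableZ => //; apply: Rintegrable_sum => // i; exact: RintegrableZ.
apply: lebesgue_ae_mono step => v /(congr1 (fun w => dot w (E v))) step _.
have M0 : M v != 0 by rewrite gt_eqF// maxwellian_gt0.
have dotD (w z y : 'cV[R]_m) (k l : R) :
    dot (k *: w + l *: z) y = k * dot w y + l * dot z y.
  rewrite /dot !mulr_sumr -big_split; apply: eq_bigr => i _ /=.
  by rewrite !mxE; ring.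
have dotZ (w y : 'cV[R]_m) (k : R) : dot (k *: w) y = k * dot w y.
  by rewrite /dot !mulr_sumr; apply: eq_bigr => i _ /=; rewrite !mxE; ring.
have dotC (w z : 'cV[R]_m) : dot w z = dot z w.
  by apply: eq_bigr => i _; rewrite mulrC.
move: step; rewrite dotD dotZ (dotC (K *m _)) (dot_skew _ Kskew) mulr0 addr0.
rewrite -mulr_suml mulrA -/(dot d (E v)) => H.
have -> : \sum_i E v i 0 ^+ 2 = dot (E v) (E v).
  by apply: eq_bigr => i _; rewrite expr2.
rewrite H; field.
exact: M0.
Qed.

End Scheme.

(** * The error estimate *)

(** Here [N] and [Q] are the squared norms of the two components of the new
    error, [X] is the squared norm of the density error [d], [Y] that of the
    micro part of the old error, and [w] is the pairing of [d] with the new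
    density, so that the equation between them is the energy identity and
    [young] is Young's inequality; the last two bounds take [delta = 2] and
    [delta = 1]. *)
Lemma holo_scalar_estimates (R : realType) (T N Q X C Y w : R) :
  0 < T -> 0 <= N -> 0 <= Q -> X <= C * Y -> (1 + T) * (N + Q) = T * w ->
  (forall delta, 0 < delta -> w <= delta / 2 * N + (2 * delta)^-1 * X) ->
  [/\ forall delta, 1 <= delta <= 2 ->
        (1 + (2 - delta) / 2 * T) * N + (1 + T) * Q <= T / (2 * delta) * C * Y,
      Q <= 1 / 4 * C * (T / (1 + T)) * Y
    & N <= C * (T / (2 + T)) * Y].
Proof.
move=> T0 N0 Q0 XY E young.
have main delta : 1 <= delta <= 2 ->
    (1 + (2 - delta) / 2 * T) * N + (1 + T) * Q <= T / (2 * delta) * C * Y.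
  move=> /andP[d1 d2]; have d0 : 0 < delta by lra.
  have : w <= delta / 2 * N + (2 * delta)^-1 * (C * Y).
    apply: (le_trans (young _ d0)); rewrite lerD2l; apply: ler_wpM2l => //.
    by rewrite invr_ge0 mulr_ge0// ltW.
  move=> /(ler_wpM2l (ltW T0)); rewrite -E => H.
  rewrite -subr_ge0 in H; rewrite -subr_ge0; apply: (le_trans H).
  by rewrite le_eqVlt; apply/orP; left; apply/eqP; field; rewrite gt_eqF.
split=> //.
  have := main 2; rewrite lexx ler1n => /(_ isT) H2.
  rewrite (_ : 1 / 4 * C * (T / (1 + T)) * Y = T / (2 * 2) * C * Y / (1 + T)).
    by rewrite ler_pdivlMr; [nra|lra].
  by field; rewrite gt_eqF// addr_gt0.
have := main 1; rewrite lexx ler1n => /(_ isT) H1.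
rewrite (_ : C * (T / (2 + T)) * Y = T / (2 * 1) * C * Y * 2 / (2 + T)).
  by rewrite ler_pdivlMr; [nra|lra].
by field; rewrite gt_eqF// addr_gt0.
Qed.

(** The resolvent bound with [s = u0 dt], [t = dt] and [rho = 1 / h] produces
    exactly the constant [C_HL]. *)
Lemma le_C_HL (R : realType) (u0 theta0 dt h x y z : R) :
  z <= theta0 * y ->
  (1 + (u0 * dt) ^+ 2 * h^-1 ^+ 2) * x <= dt ^+ 2 * h^-1 ^+ 2 * z ->
  x <= C_HL u0 theta0 dt h * y.
Proof.
move=> zy; rewrite /C_HL exprMn exprVn -(mulrA (u0 ^+ 2)).
have := sqr_ge0 u0; have : 0 <= dt ^+ 2 / h ^+ 2 by rewrite divr_ge0 ?sqr_ge0.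
move: (u0 ^+ 2) (dt ^+ 2 / h ^+ 2) => u t t0 u_ge0 H.
have D0 : 0 < 1 + u * t by nra.
have -> : theta0 * t / (1 + u * t) * y = t * (theta0 * y) / (1 + u * t).
  by field; rewrite gt_eqF.
by rewrite ler_pdivlMr// mulrC (le_trans H)// ler_wpM2l.
Qed.

Theorem proposition4p2 (R : realType) (a b : R) (hab : a < b)
  (u0 theta0 : R) (htheta0 : 0 < theta0)
  (V : set (R -> R)) (hV : L2_findim a b V)
  (h : R) (hh : 0 < h)
  (A : (R -> R) -> R -> R) (hA : linear_operator V A)
  (hskew : skew_symmetric a b V A) (hspec : imaginary_spectrum V A h)
  (nu dt : R) (hnu : 0 < nu) (hdt : 0 < dt)
  (fk : R -> R -> R) (hfk : kinetic_space a b u0 theta0 V fk)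
  (fk1 : R -> R -> R) (hfk1 : kinetic_space a b u0 theta0 V fk1)
  (hBE : backward_euler a b u0 theta0 nu dt A fk fk1)
  (f : nat -> R -> R -> R) (hf : forall l, kinetic_space a b u0 theta0 V (f l))
  (n : nat -> R -> R) (hHOLO : HOLO_iteration a b u0 theta0 nu dt V A fk f n) :
  let e := fun (l : nat) (x v : R) => f l x v - fk1 x v in
  let P := proj_M u0 theta0 in
  let Pperp := proj_M_perp u0 theta0 in
  let norm := norm_M a b u0 theta0 in
  let C := C_HL u0 theta0 dt h in
  forall l : nat,
  [/\ forall delta : R, 1 <= delta <= 2 ->
        (1 + (2 - delta) / 2 * (nu * dt)) * norm (P (e l.+1)) ^+ 2
          + (1 + nu * dt) * norm (Pperp (e l.+1)) ^+ 2
        <= nu * dt / (2 * delta) * C * norm (Pperp (e l)) ^+ 2,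
      norm (Pperp (e l.+1)) ^+ 2
        <= 1 / 4 * C * (nu * dt / (1 + nu * dt)) * norm (Pperp (e l)) ^+ 2
    & norm (P (e l.+1)) ^+ 2
        <= C * (nu * dt / (2 + nu * dt)) * norm (Pperp (e l)) ^+ 2].
Proof.
move=> e P Pperp norm C l.
have [m [phi [phi_on phi_gen]]] := orthonormal_basis hV.
pose K := operator_mx a b phi A.
pose coef (g : R -> R -> R) := fun v => coords a b phi (fun x => g x v).
have expand g : kinetic_space a b u0 theta0 V g -> expands phi u0 theta0 (coef g) g.
  exact: (kinetic_expands hV phi_on phi_gen htheta0).
have fkE := expand _ hfk; have fk1E := expand _ hfk1.
have [nV low step] := hHOLO l.
pose E j v := coef (f j) v - coef fk1 v.
have eE j : expands phi u0 theta0 (E j) (e j).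
  exact: (expandsB htheta0 (expand _ (hf j)) fk1E).
have PE (j : nat) : norm (P (e j)) ^+ 2 = sqnorm (massv (E j)).
  rewrite /norm (norm_M_expands hV phi_on htheta0 (proj_expands htheta0 (eE j))).
  apply: eq_bigr => i _; set k := massv (E j) i 0.
  transitivity (\int[lebesgue_measure]_v (k ^+ 2 * maxwellian u0 theta0 v)).
    apply: eq_Rintegral => v _; rewrite [X in X ^+ 2]mxE -/k; field.
    by rewrite gt_eqF// maxwellian_gt0.
  rewrite (RintegralZl _ measurableT (integrable_maxwellian u0 htheta0)).
  by rewrite Rintegral_maxwellian// mulr1.
have PperpE (j : nat) : norm (Pperp (e j)) ^+ 2 =
    \sum_i energy u0 theta0 (micro u0 theta0 (fun v => E j v i 0)).
  rewrite /norm (norm_M_expands hV phi_on htheta0 (proj_perp_expands htheta0 (eE j))).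
  by apply: eq_bigr => i _; rewrite micro_coords.
pose d := coords a b phi (n l.+1) - massv (coef fk1).
have Kskew : K^T = - K := operator_mx_skew phi_on hskew.
have densE := density_expands htheta0 fk1E.
have densV : V (density fk1) by rewrite densE; exact: (combine_space hV phi_on).
have coordsE : coords a b phi (density fk1) = massv (coef fk1).
  by rewrite densE (coords_combine hV phi_on).
have stepE := kinetic_step_coords hV phi_on phi_gen hA fkE (expand _ (hf l.+1)) nV step.
have stepBE := kinetic_step_coords hV phi_on phi_gen hA fkE fk1E densV hBE.
rewrite coordsE in stepBE.
have lowE := low_order_step_coords hV phi_on phi_gen hA htheta0 fkE (expand _ (hf l)) nV low.
have lowBE := kinetic_step_moment htheta0 fkE fk1E stepBE.
have fluxE := fluxvB htheta0 (expand _ (hf l)) fk1E.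
have fluxle : sqnorm (fluxv u0 theta0 (E l)) <= theta0 * norm (Pperp (e l)) ^+ 2.
  rewrite PperpE mulr_sumr; apply: ler_sum => i _; rewrite mxE.
  exact: (flux_sqr_le htheta0 ((eE l).2 i)).
have dle : sqnorm d <= C * norm (Pperp (e l)) ^+ 2.
  apply: (le_C_HL fluxle); rewrite fluxE; apply: skew_resolvent_boundB lowE lowBE => //.
  exact: (operator_mx_le hV phi_on phi_gen hA hh hskew hspec).
have energyE : (1 + nu * dt) * (norm (P (e l.+1)) ^+ 2 + norm (Pperp (e l.+1)) ^+ 2) =
    nu * dt * dot d (massv (E l.+1)).
  rewrite PE PperpE -big_split /=.
  rewrite -(kinetic_energy_identity htheta0 Kskew (eE l.+1)
    (kinetic_step_error stepE stepBE)).
  congr (_ * _); apply: eq_bigr => i _.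
  by rewrite (energy_pythagoras htheta0 ((eE l.+1).2 i)) mxE.
have young delta : 0 < delta -> dot d (massv (E l.+1)) <=
    delta / 2 * norm (P (e l.+1)) ^+ 2 + (2 * delta)^-1 * sqnorm d.
  by move=> delta_gt0; rewrite PE; exact: young_dot.
exact: (holo_scalar_estimates (mulr_gt0 hnu hdt) (sqr_ge0 _) (sqr_ge0 _)
  dle energyE young).
Qed.
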